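(* (Structure theorem) Let $U$ be an unoccupied piece. Then: (a) all arrows in the top path between the start square and the pre-top square are of left type or of up type; (b) the arrow from the pre-top square to the top square is of right type or of up type; (c) the arrow from the top square to the end square is of right type or of down type; (d) each arrow in the bottom path between the start square and the penultimate square is of right type or of down type; (e) the arrow from the penultimate square to the end square is of right type or of up type.
   Context: Consider an instance of the Square Strip Packing Problem with strip width $W$ and an ordering $S_1,\dots,S_n$ with its bottom-left packing (each square in turn is placed, without overlapping interiors and inside $[0,W]\times[0,\infty)$, at the feasible position $(x,y)$ with $(y,x)$ lexicographically minimal). Squares are closed sets. $i$-pieces: inductively for $i=1,\dots,n$, the $i$-pieces are the bounded connected components of $([0,W]\times[0,\infty))\setminus\big(\bigcup_{j\le i}S_j\cup\bigcup\{\text{$k$-pieces},\,k<i\}\big)$. An unoccupied piece is an $i$-piece for some $i$, considered in the packing of the first $i$ squares. Formal squares: $S_{\text{left}}=\{0\}\times\mathbb{R}_{\ge0}$, $S_{\text{right}}=\{W\}\times\mathbb{R}_{\ge0}$, $S_{\text{bottom}}=[0,W]\times\{0\}$. A (formal) square $S$ is adjacent to $U$ if $\overline U\cap S\ne\varnothing$; two (formal) squares are adjacent if they intersect. For a set $X$: $\mathrm{tf}(X)=\max\{y:(x,y)\in X\}$, $\mathrm{bf}(X)=\min y$, $\mathrm{lf}(X)=\min x$, $\mathrm{rf}(X)=\max x$. Arrows: an arrow is an ordered pair $(S_1,S_2)$ of adjacent (formal) squares. It is of left type if $\mathrm{lf}(S_1)=\mathrm{rf}(S_2)$, right type if $\mathrm{rf}(S_1)=\mathrm{lf}(S_2)$,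 up type if $\mathrm{tf}(S_1)=\mathrm{bf}(S_2)$, down type if $\mathrm{bf}(S_1)=\mathrm{tf}(S_2)$ (an arrow may have two types). The (formal) squares adjacent to $U$, taken in the order in which they are met when traversing the boundary of $U$ clockwise (so $U$ lies to the right), form a directed circuit $C$ visiting each of them exactly once. Start square: an adjacent square with lowest top face, leftmost among ties. Top square: an adjacent square with highest bottom face, rightmost among ties. End square: successor of the top square on $C$. Pre-top square: predecessor of the top square on $C$. Penultimate square: successor of the end square on $C$. Top path: the directed path along $C$ from the start square to the end square passing through the top square. Bottom path: the other path between start and end square on $C$, directed from the start square to the end square (it does not pass through the top square, and its last arrow goes from the penultimate square to the end square). *)

(* Defs.v *)
From HB Require Import structures.
From mathcomp Require Import all_boot all_order all_algebra.
From mathcomp Require Import all_classical all_reals.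
From mathcomp Require Import ereal topology normedtype.
Import numFieldNormedType.Exports.
Set Implicit Arguments. Unset Strict Implicit. Unset Printing Implicit Defensive.
Import Order.TTheory GRing.Theory Num.Theory.
Local Open Scope classical_set_scope.
Local Open Scope ring_scope.

Notation pt R := (R * R)%type.

(* Squares are indexed by nat (S_1,...,S_n correspond to 0,...,n-1);
   square k has side [size k] and bottom-left corner [pos k]. *)
Definition csq (R : realType) (s : nat -> R) (pos : nat -> pt R) (k : nat)
  : set (pt R) :=
  [set p | (pos k).1 <= p.1 <= (pos k).1 + s k /\
           (pos k).2 <= p.2 <= (pos k).2 + s k].

Definition osq (R : realType) (a : pt R) (side : R) : set (pt R) :=
  [set p | a.1 < p.1 < a.1 + side /\ a.2 < p.2 < a.2 + side].

Definition strip (R : realType) (W : R) : set (pt R) :=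
  [set p | 0 <= p.1 <= W /\ 0 <= p.2].

Definition feasible (R : realType) (W : R) (s : nat -> R) (pos : nat -> pt R)
  (k : nat) (a : pt R) : Prop :=
  0 <= a.1 /\ a.1 + s k <= W /\ 0 <= a.2 /\
  forall j, (j < k)%N -> osq a (s k) `&` osq (pos j) (s j) = set0.

Definition bottom_left (R : realType) (W : R) (n : nat) (s : nat -> R)
  (pos : nat -> pt R) : Prop :=
  forall k, (k < n)%N ->
    feasible W s pos k (pos k) /\
    forall a, feasible W s pos k a ->
      (pos k).2 < a.2 \/ ((pos k).2 = a.2 /\ (pos k).1 <= a.1).

Definition bounded_pl (R : realType) (X : set (pt R)) : Prop :=
  exists M : R, forall p, X p -> `|p.1| <= M /\ `|p.2| <= M.

Definition bcomps (R : realType) (A : set (pt R)) : set (set (pt R)) :=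
  [set C | (exists2 x, A x & C = connected_component A x) /\ bounded_pl C].

Fixpoint cover (R : realType) (W : R) (s : nat -> R) (pos : nat -> pt R)
  (k : nat) : set (pt R) :=
  match k with
  | 0 => set0
  | k'.+1 =>
      let A := cover W s pos k' `|` csq s pos k' in
      A `|` \bigcup_(C in bcomps (strip W `\` A)) C
  end.

(* the (k+1)-pieces (k 0-based: pieces created when square k is placed) *)
Definition pieces (R : realType) (W : R) (s : nat -> R) (pos : nat -> pt R)
  (k : nat) : set (set (pt R)) :=
  bcomps (strip W `\` (cover W s pos k `|` csq s pos k)).

Inductive fsq := FSq of nat | FLeft | FRight | FBottom.

Definition fsq_code (S : fsq) : nat :=
  match S with FSq j => j.+3 | FLeft => 0 | FRight => 1 | FBottom => 2 end.
Definition fsq_decode (c : nat) : option fsq :=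
  match c with 0 => Some FLeft | 1 => Some FRight | 2 => Some FBottom
  | j.+3 => Some (FSq j) end.
Lemma fsq_codeK : pcancel fsq_code fsq_decode.
Proof. by case. Qed.
HB.instance Definition _ := Countable.copy fsq (pcan_type fsq_codeK).

Definition fsq_set (R : realType) (W : R) (s : nat -> R) (pos : nat -> pt R)
  (S : fsq) : set (pt R) :=
  match S with
  | FSq k => csq s pos k
  | FLeft => [set p | p.1 = 0 /\ 0 <= p.2]
  | FRight => [set p | p.1 = W /\ 0 <= p.2]
  | FBottom => [set p | 0 <= p.1 <= W /\ p.2 = 0]
  end.

Definition fsq_valid (k : nat) (S : fsq) : Prop :=
  match S with FSq j => (j <= k)%N | _ => True end.

(* faces (extended reals: max/min, +oo/-oo when unbounded) *)
Definition tf (R : realType) (X : set (pt R)) : \bar R :=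
  ereal_sup [set (p.2)%:E | p in X].
Definition bf (R : realType) (X : set (pt R)) : \bar R :=
  ereal_inf [set (p.2)%:E | p in X].
Definition lf (R : realType) (X : set (pt R)) : \bar R :=
  ereal_inf [set (p.1)%:E | p in X].
Definition rf (R : realType) (X : set (pt R)) : \bar R :=
  ereal_sup [set (p.1)%:E | p in X].

Definition left_type (R : realType) (S1 S2 : set (pt R)) := lf S1 = rf S2.
Definition right_type (R : realType) (S1 S2 : set (pt R)) := rf S1 = lf S2.
Definition up_type (R : realType) (S1 S2 : set (pt R)) := tf S1 = bf S2.
Definition down_type (R : realType) (S1 S2 : set (pt R)) := bf S1 = tf S2.

Definition adjacent (R : realType) (U S : set (pt R)) : Prop :=
  closure U `&` S !=set0.

Definition boundary (R : realType) (U : set (pt R)) : set (pt R) :=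
  closure U `\` interior U.

(* C (a list read cyclically) is the sequence of (formal) squares adjacent to
   U (among those valid at step k), in the order met when traversing the
   boundary of U clockwise (U on the right), each visited exactly once:
   there is a simple closed curve gamma (period 1) parametrising the boundary
   of U, with U lying to the right of each straight piece of the traversal,
   and breakpoints b 0 <= b 1 <= ... <= b m = b 0 + 1 such that the arc
   gamma([b i, b (i+1)]) lies in the i-th square of C. *)
Definition clockwise_circuit (R : realType) (W : R) (s : nat -> R)
  (pos : nat -> pt R) (k : nat) (U : set (pt R)) (C : seq fsq) : Prop :=
  let m := size C in
  [/\ uniq C,
      (forall S, S \in C <->
                 (fsq_valid k S /\ adjacent U (fsq_set W s pos S))) &
  exists gamma : R -> pt R,
  [/\ continuous gamma,
      ((forall t, gamma (t + 1) = gamma t) /\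
       (forall t t', 0 <= t < 1 -> 0 <= t' < 1 -> gamma t = gamma t' -> t = t')),
      (forall p, boundary U p <-> exists t : R, (0 <= t <= 1) /\ gamma t = p),
      (* U lies to the right of the traversal *)
      (forall t0 t1, t0 < t1 -> gamma t0 <> gamma t1 ->
         (forall t, t0 <= t <= t1 -> exists l : R, (0 <= l <= 1) /\
             gamma t = ((gamma t0).1 + l * ((gamma t1).1 - (gamma t0).1),
                        (gamma t0).2 + l * ((gamma t1).2 - (gamma t0).2))) ->
         let d := ((gamma t1).1 - (gamma t0).1, (gamma t1).2 - (gamma t0).2) in
         let mid := (((gamma t0).1 + (gamma t1).1) / 2,
                     ((gamma t0).2 + (gamma t1).2) / 2) in
         exists del : R, 0 < del /\ forall eps : R, 0 < eps < del ->
           U (mid.1 + eps * d.2, mid.2 - eps * d.1)) &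
      exists b : nat -> R,
        [/\ (forall i, (i < m)%N -> b i <= b i.+1), b m = b 0 + 1 &
            forall i, (i < m)%N -> forall t, b i <= t <= b i.+1 ->
              fsq_set W s pos (nth FBottom C i) (gamma t)]]].

Definition cnth (C : seq fsq) (i : nat) : fsq := nth FBottom C (i %% size C).
Definition fwd (C : seq fsq) (i j : nat) : nat :=
  ((j %% size C) + size C - (i %% size C)) %% size C.

Definition is_start (R : realType) (W : R) (s : nat -> R) (pos : nat -> pt R)
  (C : seq fsq) (i : nat) : Prop :=
  (i < size C)%N /\ forall j, (j < size C)%N ->
    let Si := fsq_set W s pos (cnth C i) in
    let Sj := fsq_set W s pos (cnth C j) in
    (tf Si <= tf Sj)%E /\ (tf Si = tf Sj -> (lf Si <= lf Sj)%E).

Definition is_top (R : realType) (W : R) (s : nat -> R) (pos : nat -> pt R)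
  (C : seq fsq) (i : nat) : Prop :=
  (i < size C)%N /\ forall j, (j < size C)%N ->
    let Si := fsq_set W s pos (cnth C i) in
    let Sj := fsq_set W s pos (cnth C j) in
    (bf Sj <= bf Si)%E /\ (bf Si = bf Sj -> (rf Sj <= rf Si)%E).

(* Main.v *)
(** Every square rests on an earlier square or on the floor, and leans to the left
    on an earlier square or on the wall; iterating gives a bottom and a left
    support chain, monotone barriers which the (open part of the) piece cannot
    cross.

    At the transition point of an arrow of the circuit the piece fills one of the
    four quadrants, and the clockwise orientation restricts the quadrants filled by
    the two squares.  This leaves an arrow that is neither of left nor of up type
    only two ways of occurring: either the squares meet along a vertical line with
    the piece below the transition point, or along a horizontal line with the piece
    to its left.  In the first case the bottom chains of the two squares enclose the
    piece below the transition point, so that one of them has maximal bottom face,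
    which makes it the top square (in the degenerate case of a common corner, the
    second one is the end square).  In the second case the left chains enclose the
    piece to the left of the transition point.  If the end square were not one of the
    two, its bottom chain would keep the piece to its west, and the left chain of
    the upper square, unable to cross that bottom chain, would pass below the end
    square and cut the piece off from the top square. *)
Require Import Defs.
From HB Require Import structures.
From mathcomp Require Import all_boot all_order all_algebra.
From mathcomp Require Import all_classical all_reals.
From mathcomp Require Import ereal topology normedtype.
From mathcomp Require Import unstable ring lra zify.
Import numFieldNormedType.Exports.
Set Implicit Arguments. Unset Strict Implicit. Unset Printing Implicit Defensive.
Import Order.TTheory GRing.Theory Num.Theory.
Local Open Scope classical_set_scope.
Local Open Scope ring_scope.

(** * Plane sets and quadrants *)

(** No Jordan curve theorem is invoked. Globally, a chain is a barrier because the points west and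
    the points east of it form two closed sets that are disjoint on the piece and cover its part
    below the top of the chain; connectedness then decides the side. Locally, the orientation is
    used only near a transition point, where every rectangle looks like a union of quadrants and the
    boundary lies on a cross; the arrow types are then a finite check on Booleans. Left chains are
    bottom chains after exchanging the coordinates, so the geometry is set up for rectangles, a
    class closed under this exchange and containing the thickened walls. A piece may contain points
    of the walls and of the floor; barrier arguments therefore use its open part, which has the same
    closure. Reversing an arrow turns left into right and up into down. Hence (a) and (d) are one
    claim on arrows in the direction of the circuit: those avoiding both the top and the end square
    are of left or up type. *)

Lemma lt_or_le (R : realDomainType) (x y : R) : x < y \/ y <= x.
Proof. by case: (ltP x y); [left|right]. Qed.

Lemma le_or_lt (R : realDomainType) (x y : R) : x <= y \/ y < x.
Proof. by case: (leP x y); [left|right]. Qed.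

Section Plane.
Variable R : realType.
Implicit Types (V A B : set (pt R)) (p u z : pt R).

Lemma closed_halfplane (a b c : R) :
  closed [set p : pt R | a * p.1 + b * p.2 <= c].
Proof.
apply: (@closed_comp _ _ (fun p : pt R => a * p.1 + b * p.2) [set x | x <= c]);
  last exact: closed_le.
move=> p _; apply: cvgD; apply: cvgM; (try exact: cvg_cst).
  exact: cvg_fst.
exact: cvg_snd.
Qed.

Lemma closed_fst_le (c : R) : closed [set p : pt R | p.1 <= c].
Proof.
rewrite (_ : [set p : pt R | _] = [set p : pt R | 1 * p.1 + 0 * p.2 <= c]).
  exact: closed_halfplane.
by apply/seteqP; split => p /=; rewrite mul1r mul0r addr0.
Qed.

Lemma closed_snd_le (c : R) : closed [set p : pt R | p.2 <= c].
Proof.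
rewrite (_ : [set p : pt R | _] = [set p : pt R | 0 * p.1 + 1 * p.2 <= c]).
  exact: closed_halfplane.
by apply/seteqP; split => p /=; rewrite mul1r mul0r add0r.
Qed.

Lemma closed_fst_ge (c : R) : closed [set p : pt R | c <= p.1].
Proof.
rewrite (_ : [set p : pt R | _] = [set p : pt R | (-1) * p.1 + 0 * p.2 <= - c]).
  exact: closed_halfplane.
by apply/seteqP; split => p /=; lra.
Qed.

Lemma closed_snd_ge (c : R) : closed [set p : pt R | c <= p.2].
Proof.
rewrite (_ : [set p : pt R | _] = [set p : pt R | 0 * p.1 + (-1) * p.2 <= - c]).
  exact: closed_halfplane.
by apply/seteqP; split => p /=; lra.
Qed.

(** On [V] the set [A] is the complement of [B], hence open as well as closed. This is the
    separation argument behind [all_west] and [junction_enclosure]. *)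
Lemma connected_closed_cover (T : topologicalType) (V A B : set T) :
  connected V -> closed A -> closed B -> V `<=` A `|` B ->
  V `&` A `&` B = set0 -> V `&` A !=set0 -> V `<=` A.
Proof.
move=> cV clA clB VAB VAB0 VA0.
suff <- : V `&` A = V by move=> x [].
apply: cV => //; last by exists A.
exists (~` B); first exact: closed_openC.
apply/seteqP; split => x [Vx]; last first.
  by move=> nBx; split => //; case: (VAB _ Vx).
move=> Ax; split => // Bx.
by have : (V `&` A `&` B) x by []; rewrite VAB0.
Qed.

Lemma pt_nbhsP p (A : set (pt R)) : nbhs p A <->
  exists2 r : R, 0 < r & forall q, `|q.1 - p.1| < r -> `|q.2 - p.2| < r -> A q.
Proof.
split.
  move/nbhs_ballP => [r /= r0 rA]; exists r => // q q1 q2; apply: rA.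
  by split; rewrite /ball /= distrC.
move=> [r r0 rA]; apply/nbhs_ballP; exists r => // q [/= q1 q2].
by apply: rA; rewrite distrC.
Qed.

Lemma pt_closureP p (A : set (pt R)) : closure A p <->
  forall r : R, 0 < r ->
    exists q, [/\ A q, `|q.1 - p.1| < r & `|q.2 - p.2| < r].
Proof.
split.
  move=> cA r r0.
  have /cA[q [Aq [q1 q2]]] : nbhs p [set q | `|q.1 - p.1| < r /\ `|q.2 - p.2| < r].
    by apply/pt_nbhsP; exists r.
  by exists q.
move=> H B /pt_nbhsP[r /H[q [Aq q1 q2]] rB].
by exists q; split => //; apply: rB.
Qed.

Lemma closure_sub_closed V A : closed A -> V `<=` A -> closure V `<=` A.
Proof. by move=> cA VA; rewrite closureE; apply: smallest_sub. Qed.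

Definition sg (a : bool) : R := if a then 1 else -1.

(** Throughout, [true] means east in the first Boolean and north in the second. *)
Definition quadrant_in V (a b : bool) p : Prop :=
  exists2 r : R, 0 < r & forall s t, 0 < s < r -> 0 < t < r ->
    V (p.1 + sg a * s, p.2 + sg b * t).

Lemma quadrant_in_near V a b p (e : R) : quadrant_in V a b p -> 0 < e ->
  exists s t, [/\ 0 < s < e, 0 < t < e & V (p.1 + sg a * s, p.2 + sg b * t)].
Proof.
move=> [r r0 rV] e0; pose m := Num.min r e / 2.
have m0 : 0 < Num.min r e by rewrite lt_min r0.
have mr : Num.min r e <= r by rewrite ge_min lexx.
have me : Num.min r e <= e by rewrite ge_min lexx orbT.
by exists m, m; split; last apply: rV; rewrite /m; lra.
Qed.

Definition swap_set V : set (pt R) := [set p | V (swap p)].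

Lemma quadrant_in_swap V a b p :
  quadrant_in V a b p -> quadrant_in (swap_set V) b a (swap p).
Proof. by move=> [r r0 rV]; exists r => // s t hs ht; exact: rV. Qed.

Lemma closure_swap V p : closure V p -> closure (swap_set V) (swap p).
Proof.
move=> /pt_closureP H; apply/pt_closureP => r /H[q [Vq q1 q2]].
by exists (swap q); split => //; rewrite /swap_set /swap /=; case: (q) Vq.
Qed.

Lemma connected_swap V : connected V -> connected (swap_set V).
Proof.
move=> cV.
have -> : swap_set V = swap @` V.
  apply/seteqP; split => p; first by move=> Vp; exists (swap p) => //; case: p Vp.
  by move=> [q Vq <-]; case: q Vq.
apply: connected_continuous_connected => //.
by apply: continuous_subspaceT; exact: swap_continuous.
Qed.

End Plane.

(** * Packings of rectangles and support chains *)

Record rect (R : realType) := Rect { xmin : R; xmax : R; ymin : R; ymax : R }.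

Section Rectangles.
Variables (R : realType) (I : eqType).
Implicit Types (f : I -> rect R) (P : I -> Prop) (V : set (pt R)) (p u z : pt R).
Implicit Types (l : seq I).

Definition in_rect (S : rect R) p : Prop :=
  xmin S <= p.1 <= xmax S /\ ymin S <= p.2 <= ymax S.

(** The half-open bounds say exactly that [S] contains [p] together with a small box at [p] in the
    given quadrant. *)
Definition in_quadrant (S : rect R) (a b : bool) p : Prop :=
  (if a then xmin S <= p.1 < xmax S else xmin S < p.1 <= xmax S) /\
  (if b then ymin S <= p.2 < ymax S else ymin S < p.2 <= ymax S).

Definition swap_rect (S : rect R) : rect R :=
  Rect (ymin S) (ymax S) (xmin S) (xmax S).

Record packing f P V : Prop := Packing {
  packing_nondeg : forall i, P i ->
    xmin (f i) < xmax (f i) /\ ymin (f i) < ymax (f i);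
  packing_disj : forall i j, P i -> P j -> i <> j ->
    [\/ xmax (f i) <= xmin (f j), xmax (f j) <= xmin (f i),
        ymax (f i) <= ymin (f j) | ymax (f j) <= ymin (f i)];
  packing_connected : connected V;
  packing_free : forall i p, P i -> V p -> ~ in_rect (f i) p;
  packing_pos : forall p, V p -> 0 < p.1 /\ 0 < p.2 }.

Lemma packing_swap f P V : packing f P V ->
  packing (swap_rect \o f) P (swap_set V).
Proof.
case=> nd dj cV fV pV; split.
- by move=> i /nd[].
- by move=> i j Pi Pj /(dj _ _ Pi Pj) []; [apply: Or43|apply: Or44|apply: Or41|apply: Or42].
- exact: connected_swap.
- by move=> i p /fV/[apply] + [h1 h2]; apply; split.
- by move=> p /pV[].
Qed.

(** A chain may stop at any member reaching down to height 0, because [packing_pos] keeps [V]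
    strictly above that level. *)
Inductive chain f P : I -> seq I -> Prop :=
| chain_ground i : P i -> ymin (f i) <= 0 -> chain f P i [:: i]
| chain_support i j l : P i -> 0 < ymin (f i) -> ymax (f j) = ymin (f i) ->
    xmin (f i) < xmax (f j) -> xmin (f j) < xmax (f i) ->
    chain f P j l -> chain f P i (i :: l).

Lemma chain_mem f P i l : chain f P i l -> i \in l.
Proof. by case=> *; rewrite mem_head. Qed.

Lemma chain_valid f P i l : chain f P i l -> forall j, j \in l -> P j.
Proof.
elim=> [j Pj _ k|j k l' Pj _ _ _ _ _ IH e]; first by rewrite inE => /eqP->.
by rewrite inE => /predU1P[->//|]; exact: IH.
Qed.

Lemma chain_below f P V i l : packing f P V -> chain f P i l ->
  forall j, j \in l -> j = i \/ ymax (f j) <= ymin (f i).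
Proof.
move=> pk; elim=> [j Pj _ k|j k l' Pj _ kj _ _ ch IH e].
  by rewrite inE => /eqP->; left.
rewrite inE => /predU1P[->|/[dup] el /IH]; first by left.
have [] := packing_nondeg pk (chain_valid ch (chain_mem ch)).
by move=> _ h [->|]; right; lra.
Qed.

Lemma chain_cover f P V i l (y : R) : packing f P V -> chain f P i l ->
  0 <= y -> y < ymax (f i) ->
  exists2 j, j \in l & ymin (f j) <= y < ymax (f j).
Proof.
move=> pk; elim=> [j Pj j0|j k l' Pj _ kj _ _ ch IH] y0 yj.
  by exists j; rewrite ?inE//; lra.
have [jy|yltj] := le_or_lt (ymin (f j)) y; first by exists j; rewrite ?inE ?eqxx//; lra.
by have [|e el ey] := IH y0; [lra|exists e; rewrite ?inE ?el ?orbT].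
Qed.

(** Members are half-open at the bottom here, since below a junction the height is approached from
    below. The disjunction records the one relation needed later: at the bottom of the head, the
    member found is its direct support and overlaps it horizontally. *)
Lemma chain_cover_below f P V i l (y : R) : packing f P V -> chain f P i l ->
  0 < y -> y <= ymax (f i) ->
  exists2 j, j \in l & ymin (f j) < y <= ymax (f j) /\
    (j = i \/ ymin (f i) = y /\
       ymax (f j) = y /\ xmin (f i) < xmax (f j) /\ xmin (f j) < xmax (f i)
     \/ y < ymin (f i)).
Proof.
move=> pk; elim=> [j Pj j0|j k l' Pj _ kj h1 h2 ch IH] y0 yj.
  by exists j; rewrite ?inE//; split; [lra|left].
have [jy|yltj|yj2] := ltgtP (ymin (f j)) y.
- by exists j; rewrite ?inE ?eqxx//; split; [lra|left].
- have [|e el [ey _]] := IH y0; first lra.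
  by exists e; [rewrite ?inE ?el ?orbT|split => //; right; right].
- have [_ h] := packing_nondeg pk (chain_valid ch (chain_mem ch)).
  exists k; first by rewrite inE (chain_mem ch) orbT.
  by split; [lra|right; left; split; [|split; [|split]]; lra].
Qed.

Lemma chain_tail_ex f P i l : chain f P i l -> 0 < ymin (f i) ->
  forall j, j \in l -> 0 < ymin (f j) -> exists2 k, k \in l &
    [/\ ymax (f k) = ymin (f j), xmin (f j) < xmax (f k) & xmin (f k) < xmax (f j)].
Proof.
elim=> [j Pj j0|j k l' Pj _ kj h1 h2 ch IH] i0 e; first by lra.
rewrite inE => /predU1P[->|el] e0.
  by exists k; [rewrite inE (chain_mem ch) orbT|split].
have [k0|k0] := le_or_lt (ymin (f k)) 0.
  case: ch k0 el => [k1 Pk1 k1neg _|]; last by move=> *; lra.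
  by rewrite inE => /eqP ek; rewrite ek in e0; lra.
by have [k' k'l] := IH k0 e el e0; exists k' => //; rewrite inE k'l orbT.
Qed.

(* Consecutive members of a chain overlap horizontally, so an obstacle cannot
   switch sides along the chain. *)
Lemma chain_side_pt f P V i l u : packing f P V -> chain f P i l -> V u ->
  forall j k, j \in l -> k \in l -> ymin (f j) <= u.2 <= ymax (f j) ->
  ymin (f k) <= u.2 <= ymax (f k) -> u.1 < xmin (f j) -> u.1 < xmin (f k).
Proof.
move=> pk; elim=> [i0 Pi0 _ Vu j k|i0 j0 l' Pi0 _ j0i h1 h2 ch IH Vu j k].
  by rewrite !inE => /eqP-> /eqP->.
have out e : P e -> ymin (f e) <= u.2 <= ymax (f e) ->
    u.1 < xmin (f e) \/ xmax (f e) < u.1.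
  move=> Pe ue; case: (lt_or_le u.1 (xmin (f e))) => [|h]; first by left.
  case: (lt_or_le (xmax (f e)) u.1) => [|h']; first by right.
  by case: (packing_free pk Pe Vu); split; rewrite ?h ?h'.
have Pj0 := chain_valid ch (chain_mem ch).
have [_ j0nd] := packing_nondeg pk Pj0.
have top e : e \in l' -> ymin (f i0) <= u.2 -> u.2 <= ymax (f e) ->
    e = j0 /\ u.2 = ymin (f i0).
  by move=> el ui ue; case: (chain_below pk ch el) ue => [->|]; [split=> //|]; lra.
rewrite !inE => /predU1P[->|jl] /predU1P[->|kl] // uj uk.
- have [||kj0 u2] := top k kl; [lra|lra|rewrite kj0 in uk *].
  by have [//|h|h] := out j0 Pj0; lra.
- have [||jj0 u2] := top j jl; [lra|lra|rewrite jj0 in uj *].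
  by have [//|h|h] := out i0 Pi0; lra.
- exact: IH.
Qed.

(** The same principle with a rectangle as obstacle, which may itself belong to the chain; hence the
    alternatives [j = c] and [k = c]. All members between [j] and [k] share heights with [c], so a
    change of side would separate two overlapping neighbours by the width of [c]. *)
Lemma chain_side_rect f P V i l c : packing f P V -> chain f P i l -> P c ->
  forall j k, j \in l -> k \in l ->
  ymin (f j) < ymax (f c) -> ymin (f c) < ymax (f j) ->
  ymin (f k) < ymax (f c) -> ymin (f c) < ymax (f k) ->
  j = c \/ xmax (f c) <= xmin (f j) -> k = c \/ xmax (f c) <= xmin (f k).
Proof.
move=> pk; elim=> [i0 Pi0 _ Pc j k|i0 j0 l' Pi0 _ j0i h1 h2 ch IH Pc j k].
  by rewrite !inE => /eqP-> /eqP->.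
have [cnd _] := packing_nondeg pk Pc.
have Pj0 := chain_valid ch (chain_mem ch).
have [_ j0nd] := packing_nondeg pk Pj0.
have [_ i0nd] := packing_nondeg pk Pi0.
have below e : e \in l' -> ymax (f e) <= ymin (f i0).
  by move=> el; case: (chain_below pk ch el) => [->|]; lra.
have mid e : e \in l' -> ymin (f i0) < ymax (f c) -> ymin (f c) < ymax (f i0) ->
    ymin (f e) < ymax (f c) -> ymin (f c) < ymax (f e) ->
    ymin (f j0) < ymax (f c) /\ ymin (f c) < ymax (f j0).
  by move=> el; have := below e el; lra.
have out e : P e -> ymin (f e) < ymax (f c) -> ymin (f c) < ymax (f e) ->
    e = c \/ e <> c /\ (xmax (f c) <= xmin (f e) \/ xmax (f e) <= xmin (f c)).
  move=> Pe e1 e2; have [ec|/eqP ec] := eqVneq e c; [by left|right; split => //].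
  by case: (packing_disj pk Pe Pc ec) => h; [right|left|lra|lra].
rewrite !inE => /predU1P[->|jl] /predU1P[->|kl] // j1 j2 k1 k2.
- have [a1 a2] := mid k kl j1 j2 k1 k2; move=> hj; apply: (IH Pc j0 k (chain_mem ch)) => //.
  case: (out _ Pj0 a1 a2) => [|[_ [|h]]]; [by left|by right|].
  by case: hj => [ei|hj]; [rewrite ei in h1 h2 *|]; lra.
- have [a1 a2] := mid j jl k1 k2 j1 j2; move=> hj.
  have := IH Pc j j0 jl (chain_mem ch) j1 j2 a1 a2 hj.
  case: (out _ Pi0 k1 k2) => [|[_ [|h]]]; [by left|by right|].
  by case=> [ei|hj']; [rewrite ei in j0i a2|]; lra.
- by move=> hj; apply: (IH Pc j k).
Qed.

End Rectangles.

(** * Chains as barriers and the region enclosed below a junction *)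

Section Enclosure.
Variables (R : realType) (I : eqType).
Implicit Types (f : I -> rect R) (P : I -> Prop) (V : set (pt R)) (p u z : pt R).
Implicit Types (l : seq I).

Lemma closed_seq_ex (g : I -> set (pt R)) l : (forall e, closed (g e)) ->
  closed [set p | exists2 e, e \in l & g e p].
Proof.
move=> cg; elim: l => [|e l IH].
  by rewrite (_ : [set p | _] = set0); [exact: closed0|apply/seteqP; split => p []].
rewrite (_ : [set p | _] = g e `|` [set p | exists2 e, e \in l & g e p]).
  exact: closedU.
apply/seteqP; split => p /=.
  by case=> e'; rewrite inE => /predU1P[->|el]; [left|right; exists e'].
by case=> [gp|[e' el gp]]; [exists e; rewrite ?inE ?eqxx|exists e'; rewrite ?inE ?el ?orbT].
Qed.

Definition west_of f l : set (pt R) :=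
  [set p | exists2 e, e \in l & ymin (f e) <= p.2 <= ymax (f e) /\ p.1 <= xmin (f e)].
Definition east_of f l : set (pt R) :=
  [set p | exists2 e, e \in l & ymin (f e) <= p.2 <= ymax (f e) /\ xmax (f e) <= p.1].

Lemma closed_west_of f l : closed (west_of f l).
Proof.
apply: (closed_seq_ex (g := fun e => [set p | _ /\ _])) => e.
rewrite (_ : [set p | _] = ([set p | ymin (f e) <= p.2] `&` [set p | p.2 <= ymax (f e)])
   `&` [set p | p.1 <= xmin (f e)]).
  apply: closedI; [apply: closedI|]; [exact: closed_snd_ge|exact: closed_snd_le|].
  exact: closed_fst_le.
by apply/seteqP; split => p /= => [[/andP[]]|[[-> ->]]].
Qed.

Lemma closed_east_of f l : closed (east_of f l).
Proof.
apply: (closed_seq_ex (g := fun e => [set p | _ /\ _])) => e.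
rewrite (_ : [set p | _] = ([set p | ymin (f e) <= p.2] `&` [set p | p.2 <= ymax (f e)])
   `&` [set p | xmax (f e) <= p.1]).
  apply: closedI; [apply: closedI|]; [exact: closed_snd_ge|exact: closed_snd_le|].
  exact: closed_fst_ge.
by apply/seteqP; split => p /= => [[/andP[]]|[[-> ->]]].
Qed.

Lemma free_side f P V e u : packing f P V -> P e -> V u ->
  ymin (f e) <= u.2 <= ymax (f e) -> u.1 < xmin (f e) \/ xmax (f e) < u.1.
Proof.
move=> pk Pe Vu ue; case: (lt_or_le u.1 (xmin (f e))) => [|h]; first by left.
case: (lt_or_le (xmax (f e)) u.1) => [|h']; first by right.
by case: (packing_free pk Pe Vu); split; rewrite ?h ?h'.
Qed.

(** Where one member rests on another, both contain the height [u.2]; [chain_side_pt] makes the side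
    independent of the member chosen. *)
Lemma west_ofP f P V i l u : packing f P V -> chain f P i l -> V u -> west_of f l u ->
  forall e, e \in l -> ymin (f e) <= u.2 <= ymax (f e) -> u.1 < xmin (f e).
Proof.
move=> pk ch Vu [e' el' [h1 h2]] e el h.
apply: (chain_side_pt pk ch Vu el' el h1 h).
have [//|] := free_side pk (chain_valid ch el') Vu h1.
have [] := packing_nondeg pk (chain_valid ch el'); lra.
Qed.

Lemma east_ofP f P V i l u : packing f P V -> chain f P i l -> V u -> east_of f l u ->
  forall e, e \in l -> ymin (f e) <= u.2 <= ymax (f e) -> xmax (f e) < u.1.
Proof.
move=> pk ch Vu [e' el' [h1 h2]] e el h.
have [h3|//] := free_side pk (chain_valid ch el) Vu h.
have [] := packing_nondeg pk (chain_valid ch el').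
by have := chain_side_pt pk ch Vu el el' h h1 h3; lra.
Qed.

Lemma west_or_east f P V i l u : packing f P V -> chain f P i l -> V u ->
  u.2 < ymax (f i) -> west_of f l u \/ east_of f l u.
Proof.
move=> pk ch Vu ui; have [_ u0] := packing_pos pk Vu.
have [e el eu] := chain_cover pk ch (ltW u0) ui.
by have [|h|h] := free_side pk (chain_valid ch el) Vu (e := e);
  [lra|left; exists e => //; split; lra|right; exists e => //; split; lra].
Qed.

Lemma west_east_disj f P V i l u : packing f P V -> chain f P i l -> V u ->
  west_of f l u -> east_of f l u -> False.
Proof.
move=> pk ch Vu w; have := w => -[e el [eu _]] ea.
have := west_ofP pk ch Vu w el eu; have := east_ofP pk ch Vu ea el eu.
by have [] := packing_nondeg pk (chain_valid ch el); lra.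
Qed.

Lemma all_west f P V i l u0 : packing f P V -> chain f P i l ->
  (forall u, V u -> u.2 < ymax (f i)) -> V u0 -> west_of f l u0 ->
  V `<=` west_of f l.
Proof.
move=> pk ch Vi Vu0 w0.
apply: (connected_closed_cover (packing_connected pk) (@closed_west_of f l) (@closed_east_of f l)).
- by move=> u Vu; apply: (west_or_east pk ch Vu); exact: Vi.
- by apply/seteqP; split => // u [[Vu w] e]; case: (west_east_disj pk ch Vu w e).
- by exists u0.
Qed.

(* Together with their bottom support chains, [S1] and [S2] enclose [V] below [p]. *)
Record junction f P V p S1 S2 : Prop := Junction {
  junction_valid1 : P S1; junction_valid2 : P S2;
  junction_x1 : xmax (f S1) = p.1; junction_x2 : xmin (f S2) = p.1;
  junction_y1 : ymin (f S1) <= p.2 < ymax (f S1);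
  junction_y2 : ymin (f S2) <= p.2 <= ymax (f S2);
  junction_V : exists a, quadrant_in V a false p }.

Lemma packing_overlap f P V i j : packing f P V -> P i -> P j ->
  xmin (f i) < xmax (f j) -> xmin (f j) < xmax (f i) ->
  ymin (f i) < ymax (f j) -> ymin (f j) < ymax (f i) -> i = j.
Proof.
move=> pk Pi Pj x1 x2 y1 y2; apply: contrapT => ij.
by case: (packing_disj pk Pi Pj ij); rewrite leNgt ?x1 ?x2 ?y1 ?y2.
Qed.

(** [e1] and [e2] bound the gap through which [V] reaches the height [p.2] from below. Each is [S1],
    resp. [S2], or its direct support when the bottom lies exactly at that height. *)
Lemma junction_chains f P V p S1 S2 l1 l2 : packing f P V ->
  junction f P V p S1 S2 -> chain f P S1 l1 -> chain f P S2 l2 ->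
  exists e1 e2, [/\ e1 \in l1, e2 \in l2,
    ymin (f e1) < p.2 <= ymax (f e1), ymin (f e2) < p.2 <= ymax (f e2) &
    [/\ xmin (f S1) < xmax (f e1), xmin (f e1) < p.1, p.1 < xmax (f e2),
      ymin (f S2) = p.2 -> xmin (f e2) < xmax (f S2) &
      ymin (f S2) < p.2 -> xmin (f e2) = p.1]].
Proof.
move=> pk [P1 P2 x1 x2 y1 y2 [a qa]] ch1 ch2.
have p0 : 0 < p.2.
  have [s [t [_ ht /(packing_pos pk)[_ /=]]]] := quadrant_in_near qa (@ltr01 R).
  by rewrite /sg; lra.
have [nd1 _] := packing_nondeg pk P1; have [nd2 _] := packing_nondeg pk P2.
have [|e1 e1l [ey1 ex1]] := chain_cover_below pk ch1 p0; first by lra.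
have [|e2 e2l [ey2 ex2]] := chain_cover_below pk ch2 p0; first by lra.
exists e1, e2; split => //; clear - x1 x2 y1 y2 nd1 nd2 ex1 ex2.
have [h1 h2] : xmin (f S1) < xmax (f e1) /\ xmin (f e1) < p.1.
  by case: ex1 => [->|[[_ [_ [h h']]]|h]]; [split|split|exfalso]; lra.
split => //; case: ex2 => [->|[[h3 [_ [h h']]]|h]] => *; lra.
Qed.

(** The enclosed region is closed; so is the rest, once both are cut at height [p.2]. They could
    share points of [V] only at that height, where [S1] and [S2] plug the gap between the two
    chains. *)
Lemma junction_enclosure f P V p S1 S2 l1 l2 : packing f P V ->
  junction f P V p S1 S2 -> chain f P S1 l1 -> chain f P S2 l2 ->
  V `<=` [set u | u.2 < p.2 /\ (east_of f l1 u /\ west_of f l2 u)].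
Proof.
move=> pk jn ch1 ch2.
have [e1 [e2 [e1l e2l ey1 ey2 [x1e e1p pe2 e2a e2b]]]] := junction_chains pk jn ch1 ch2.
have [P1 P2 x1 x2 y1 y2 [a qa]] := jn.
have Pe1 := chain_valid ch1 e1l; have Pe2 := chain_valid ch2 e2l.
pose A := ([set u : pt R | u.2 <= p.2] `&` east_of f l1) `&` west_of f l2.
pose B := ([set u : pt R | p.2 <= u.2] `|` west_of f l1) `|` east_of f l2.
have disjAB u : V u -> A u -> B u -> False.
  move=> Vu [[/= u2 ea] we] [[/= u2'|w']|e'].
  (* At this height the gap from [e1] to [e2] is filled by [S1] up to [p.1] and by [S2] from there
     on. *)
  - have eq2 : u.2 = p.2 by apply/eqP; rewrite eq_le u2 u2'.
    have h1 : xmax (f e1) < u.1.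
      by apply: (east_ofP pk ch1 Vu ea e1l); case/andP: ey1 => /ltW; rewrite eq2 => ->.
    have h2 : u.1 < xmin (f e2).
      by apply: (west_ofP pk ch2 Vu we e2l); case/andP: ey2 => /ltW; rewrite eq2 => ->.
    have [up|pu] := le_or_lt u.1 p.1.
      apply: (packing_free pk P1 Vu); clear - up eq2 x1e h1 x1 y1; split; lra.
    have [yS|yS] := lt_or_le (ymin (f S2)) p.2.
      by move: (e2b yS) h2 pu => -> /ltW; rewrite leNgt => /negbTE ->.
    apply: (packing_free pk P2 Vu); have := e2a; clear - pu eq2 x2 y2 yS h2.
    by move=> /(_ (ltac:(lra))) h; split; lra.
  - exact: (west_east_disj pk ch1 Vu w' ea).
  - exact: (west_east_disj pk ch2 Vu we e').
have VA : V `<=` A.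
  apply: (@connected_closed_cover _ _ _ B (packing_connected pk)).
  - by apply: closedI; [apply: closedI|]; [exact: closed_snd_le|exact: closed_east_of|exact: closed_west_of].
  - by apply: closedU; [apply: closedU|]; [exact: closed_snd_ge|exact: closed_west_of|exact: closed_east_of].
  - move=> u Vu; have [u2|u2] := le_or_lt p.2 u.2; first by right; left; left.
    have [|w1|w1] := west_or_east pk ch1 Vu; [lra|by right; left; right|].
    have [|w2|w2] := west_or_east pk ch2 Vu; [lra| |by right; right].
    by left; split => //; split => //=; exact: ltW.
  - by apply/seteqP; split => // u [[Vu Au] Bu]; case: (disjAB u).
  (* A point of [V] in the lower quadrant, closer than [e] to [p], shares its height with [e1] and
     [e2] and is too close to [p] to lie on their outer sides. *)
  - have [e [e0 d1 d2 [d3 d4]]] : exists e : R, [/\ 0 < e, e <= p.1 - xmin (f e1),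
        e <= xmax (f e2) - p.1 & e <= p.2 - ymin (f e1) /\ e <= p.2 - ymin (f e2)].
      exists (Num.min (Num.min (p.1 - xmin (f e1)) (xmax (f e2) - p.1))
                      (Num.min (p.2 - ymin (f e1)) (p.2 - ymin (f e2)))).
      case/andP: ey1 => ey1 _; case/andP: ey2 => ey2 _.
      by rewrite !lt_min !subr_gt0 e1p pe2 ey1 ey2 !ge_min !lexx !orbT.
    have [s [t [hs ht Vu]]] := quadrant_in_near qa e0.
    exists (p.1 + sg R a * s, p.2 + sg R false * t); split => //.
    have sa : - e < sg R a * s < e by clear - hs; rewrite /sg; case: (a); lra.
    have ea : ymin (f e1) <= p.2 + sg R false * t <= ymax (f e1).
      by clear - ht d3 ey1; rewrite /sg; lra.
    have eb : ymin (f e2) <= p.2 + sg R false * t <= ymax (f e2).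
      by clear - ht d4 ey2; rewrite /sg; lra.
    split; first split => /=.
    + by clear - ht; rewrite /sg; lra.
    + exists e1 => //; split => //=.
      by have [//|/=|/=] := free_side pk Pe1 Vu; clear - sa d1; lra.
    + exists e2 => //; split => //=.
      by have [//|/=|/=] := free_side pk Pe2 Vu; clear - sa d2; lra.
move=> u Vu; have [[u2 ea] we] := VA u Vu; split => //=.
have [//|pu] := lt_or_le u.2 p.2.
by case: (disjAB u Vu) => //; left; left.
Qed.

Lemma junction_closure f P V p S1 S2 l1 l2 z : packing f P V ->
  junction f P V p S1 S2 -> chain f P S1 l1 -> chain f P S2 l2 ->
  closure V z -> z.2 = p.2 ->
  [/\ xmin (f S1) < z.1, ymin (f S2) = p.2 -> z.1 < xmax (f S2) &
      ymin (f S2) < p.2 -> z.1 <= p.1].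
Proof.
move=> pk jn ch1 ch2 cz z2; have enc := junction_enclosure pk jn ch1 ch2.
have [e1 [e2 [e1l e2l ey1 ey2 [x1e _ _ e2a e2b]]]] := junction_chains pk jn ch1 ch2.
have [d [d0 d1 d2]] : exists d : R, [/\ 0 < d, d <= p.2 - ymin (f e1) & d <= p.2 - ymin (f e2)].
  exists (Num.min (p.2 - ymin (f e1)) (p.2 - ymin (f e2))).
  by rewrite lt_min !ge_min !lexx orbT; split=> //; clear - ey1 ey2; lra.
have near (r : R) : 0 < r ->
    exists2 u : pt R, `|u.1 - z.1| < r & xmax (f e1) < u.1 /\ u.1 < xmin (f e2).
  move=> r0; have rd : 0 < Num.min r d by rewrite lt_min r0.
  have := cz => /pt_closureP/(_ _ rd)[u [Vu]].
  rewrite lt_min => /andP[u1 _]; rewrite lt_min => /andP[_ u2].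
  have [/= up [ea we]] := enc u Vu; exists u => //.
  move: u2; rewrite z2 ltr_norml => u2.
  split; [apply: (east_ofP pk ch1 Vu ea e1l)|apply: (west_ofP pk ch2 Vu we e2l)].
    by clear - u2 up d1 ey1; lra.
  by clear - u2 up d2 ey2; lra.
have [le1 le2] : xmax (f e1) <= z.1 /\ z.1 <= xmin (f e2).
  clear - near; split; rewrite leNgt; apply/negP => h.
    have [|u] := near (xmax (f e1) - z.1); first by rewrite subr_gt0.
    by rewrite ltr_norml; lra.
  have [|u] := near (z.1 - xmin (f e2)); first by rewrite subr_gt0.
  by rewrite ltr_norml; lra.
split; first exact: lt_le_trans x1e le1.
  by move=> /e2a; exact: le_lt_trans.
by move=> /e2b <-.
Qed.

(** The touching point has height exactly [p.2] and lies over the gap. If [T] starts left of [p.1],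
    it overlaps [S1] just above this height; otherwise it overlaps [S2], unless [S2] ends there and
    [T] stands on it with aligned left sides. *)
Lemma junction_touching f P V p S1 S2 l1 l2 T z : packing f P V ->
  junction f P V p S1 S2 -> chain f P S1 l1 -> chain f P S2 l2 ->
  P T -> closure V z -> in_rect (f T) z -> p.2 <= ymin (f T) ->
  ymin (f T) = p.2 /\ [\/ T = S1, T = S2 |
    [/\ z = p, xmin (f T) = p.1 & ymax (f S2) = p.2]].
Proof.
move=> pk jn ch1 ch2 PT cz [/andP[zx1 zx2] /andP[zy1 zy2]] pT.
have enc := junction_enclosure pk jn ch1 ch2.
have z2 : z.2 <= p.2.
  by apply: (closure_sub_closed (@closed_snd_le R p.2) _ cz) => u /enc[/ltW].
have eT : ymin (f T) = p.2 by apply/eqP; rewrite eq_le pT (le_trans zy1 z2).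
have ez : z.2 = p.2 by apply/eqP; rewrite eq_le z2 -eT zy1.
have [zS1 zS2 zp] := junction_closure pk jn ch1 ch2 cz ez.
have [P1 P2 x1 x2 /andP[y1 y1'] /andP[y2 y2'] _] := jn.
have [ndT ndT'] := packing_nondeg pk PT.
split => //; clear enc jn ch1 ch2 pT zy1 zy2 z2 cz.
have [pTx|Txp] := lt_or_le (xmin (f T)) p.1.
  apply: Or31; apply: (packing_overlap pk PT P1); rewrite ?x1 ?eT //.
    exact: lt_le_trans zS1 zx2.
  by rewrite eT in ndT'; exact: le_lt_trans y1 ndT'.
have [S2p|S2p] := lt_or_le p.2 (ymax (f S2)).
  apply: Or32; apply: (packing_overlap pk PT P2); rewrite ?x2 ?eT //.
  - have [h|h] := lt_or_le (ymin (f S2)) p.2.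
      apply: le_lt_trans (le_trans zx1 (zp h)) _; rewrite -x2.
      by have [] := packing_nondeg pk P2.
    by apply: le_lt_trans zx1 (zS2 _); apply/eqP; rewrite eq_le y2 h.
  - exact: le_lt_trans Txp ndT.
  - by rewrite eT in ndT'; exact: le_lt_trans y2 ndT'.
have h : ymin (f S2) < p.2.
  by have [_ h] := packing_nondeg pk P2; exact: lt_le_trans h S2p.
have zp1 : z.1 = p.1 by apply/eqP; rewrite eq_le (zp h) (le_trans Txp zx1).
apply: Or33; split.
- by rewrite [z]surjective_pairing [p]surjective_pairing zp1 ez.
- by apply/eqP; rewrite eq_le Txp -zp1 zx1.
- by apply/eqP; rewrite eq_le S2p y2'.
Qed.

End Enclosure.

(** * A left chain cannot cross the bottom chain of the end square *)

Section Crossing.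
Variables (R : realType) (I : eqType).
Implicit Types (f : I -> rect R) (P : I -> Prop) (V : set (pt R)) (p u z : pt R).
Implicit Types (l : seq I).

Lemma quadrant_in_closure V a b p : quadrant_in V a b p -> closure V p.
Proof.
move=> q; apply/pt_closureP => r r0.
have [s [t [hs ht Vu]]] := quadrant_in_near q r0.
exists (p.1 + sg R a * s, p.2 + sg R b * t); split => //=.
  by rewrite ltr_norml; case: (a); rewrite /sg; lra.
by rewrite ltr_norml; case: (b); rewrite /sg; lra.
Qed.

Lemma closure_pos f P V p : packing f P V -> closure V p -> 0 <= p.1 /\ 0 <= p.2.
Proof.
move=> pk cp; split.
  by apply: (closure_sub_closed (@closed_fst_ge R 0) _ cp) => u /(packing_pos pk)[/ltW].
by apply: (closure_sub_closed (@closed_snd_ge R 0) _ cp) => u /(packing_pos pk)[_ /ltW].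
Qed.

Lemma west_quadrant f P V i l p b : packing f P V -> chain f P i l ->
  V `<=` west_of f l -> quadrant_in V false b p ->
  forall e, e \in l -> ymin (f e) <= p.2 < ymax (f e) -> p.1 < xmax (f e).
Proof.
move=> pk ch Vw q e el ey.
have wP u k := fun Vu => @west_ofP R I f P V i l u pk ch Vu (Vw u Vu) k.
have [nd _] := packing_nondeg pk (chain_valid ch el).
have side k : k \in l -> (if b then ymin (f k) <= p.2 < ymax (f k)
    else ymin (f k) < p.2 <= ymax (f k)) -> p.1 <= xmin (f k).
  move=> kl ky; have [//|h] := le_or_lt p.1 (xmin (f k)).
  have [d [d0 d1 d2]] : exists d : R, [/\ 0 < d, d <= p.1 - xmin (f k) &
      d <= if b then ymax (f k) - p.2 else p.2 - ymin (f k)].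
    eexists (Num.min (p.1 - xmin (f k)) (if b then ymax (f k) - p.2 else p.2 - ymin (f k))).
    rewrite lt_min !ge_min !lexx orbT; split=> //.
    by move: ky; case: (b); lra.
  have [s [t [hs ht Vu]]] := quadrant_in_near q d0.
  have /= := wP _ k Vu kl.
  have -> : ymin (f k) <= p.2 + sg R b * t <= ymax (f k).
    by move: ky d2; rewrite /sg; case: (b); lra.
  by move=> /(_ isT); rewrite /sg; lra.
have [h|h] := lt_or_le (ymin (f e)) p.2.
  by have := side e el; case: (b) => hh; have := hh (ltac:(lra)); lra.
(* What remains is the bottom edge of [e] at height [p.2] with [V] below it. The bound then comes
   from the support of [e], which is not west of [p] and overlaps [e] horizontally. *)
case: b q side => q side; first by have := side e el (ltac:(lra)); lra.
have e0 : 0 < ymin (f e).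
  have [s [t [hs ht Vu]]] := quadrant_in_near q (@ltr01 R).
  by have [_ /=] := packing_pos pk Vu; rewrite /sg; lra.
have i0 : 0 < ymin (f i) by case: (chain_below pk ch el) => [<-|] //; lra.
have [k kl [k1 k2 k3]] := chain_tail_ex ch i0 el e0.
have [_ kn] := packing_nondeg pk (chain_valid ch kl).
by have := side k kl (ltac:(lra)); lra.
Qed.

(* The left support chain of [c] starts on the west side of the bottom support
   chain of [D]; it cannot cross it, so it stays below [D] until it passes the
   corner [p], where it would cut off [V]. *)
Lemma left_chain_blocked f P V D lD p c lc : packing f P V ->
  (forall i, P i -> 0 <= ymin (f i) \/ ymax (f i) <= 0) ->
  chain f P D lD -> xmin (f D) = p.1 -> ymin (f D) < p.2 ->
  quadrant_in V false false p ->
  chain (@swap_rect R \o f) P c lc ->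
  (forall e, e \in lc -> forall u, V u -> xmin (f e) <= u.1 <= xmax (f e) ->
     u.2 < ymin (f e)) ->
  (exists2 e, e \in lD & [/\ ymin (f e) < ymax (f c), ymin (f c) < ymax (f e) &
     e = c \/ xmax (f c) <= xmin (f e)]) ->
  0 <= ymin (f c) < ymin (f D) -> xmin (f D) <= xmax (f c) -> False.
Proof.
move=> pk half chD xD yD q.
have D0 : 0 < xmin (f D).
  have [s [t [hs ht Vu]]] := quadrant_in_near q (@ltr01 R).
  by have [/= + _] := packing_pos pk Vu; rewrite /sg; lra.
have [ndD ndD'] := packing_nondeg pk (chain_valid chD (chain_mem chD)).
(* No member starting below [D] may straddle the vertical line through the left side of [D]: just
   southwest of [p] there are points of [V] above the bottom of [D], whereas [V] runs below such a
   member. *)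
have last c0 : (forall u, V u -> xmin (f c0) <= u.1 <= xmax (f c0) -> u.2 < ymin (f c0)) ->
    ymin (f c0) < ymin (f D) -> xmin (f c0) < xmin (f D) -> xmin (f D) <= xmax (f c0) -> False.
  move=> below yc xc xc'.
  have [d [d0 d1 d2]] : exists d : R, [/\ 0 < d, d <= p.1 - xmin (f c0) & d <= p.2 - ymin (f D)].
    exists (Num.min (p.1 - xmin (f c0)) (p.2 - ymin (f D))).
    by rewrite lt_min !ge_min !lexx orbT; split=> //; lra.
  have [s [t [hs ht Vu]]] := quadrant_in_near q d0.
  by have /= := below _ Vu; rewrite /sg => /(_ (ltac:(lra))); lra.
elim=> {c lc} [c Pc c0|c c' lc Pc /= c0 xc yc yc' chc IH] below [e0 e0l [o1 o2 side]] /andP[c0y cD] Dc.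
  apply: (last c) => //=; first by apply: below; rewrite inE.
  by move: c0 => /= c0; lra.
have [cx|Dx] := lt_or_le (xmin (f c)) (xmin (f D)).
  by apply: (last c) => //=; apply: below; rewrite inE eqxx.
(* If [c] and [D] shared heights, [chain_side_rect] would put [D] east of [c], against [Dx]. *)
have cD' : ymax (f c) <= ymin (f D).
  have [//|h] := le_or_lt (ymax (f c)) (ymin (f D)).
  have /= [|Dc'|h'] := chain_side_rect pk chD Pc e0l (chain_mem chD) o1 o2 h _ side.
  - lra.
  - by rewrite Dc' in cD; lra.
  - by have [] := packing_nondeg pk Pc; lra.
have Pc' := chain_valid chc (chain_mem chc).
have c'0 : 0 <= ymin (f c') by case: (half c' Pc'); lra.
(* A height common to [c] and its left support [c']. The member of the chain of [D] found there is
   [c] or lies east of it, hence lies east of [c'], which renews the invariant of the induction. *)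
pose y := Num.max (ymin (f c)) (ymin (f c')).
have [n1 n2] := packing_nondeg pk Pc; have [n1' n2'] := packing_nondeg pk Pc'.
have yge : ymin (f c) <= y /\ ymin (f c') <= y by rewrite /y !le_max !lexx orbT.
have ylt : y < ymax (f c) /\ y < ymax (f c') by rewrite /y !gt_max; split; apply/andP.
case: yge ylt => y1 y2 [y3 y4].
have [||e el ey] := chain_cover pk chD (y := y); [lra|lra|].
have Ee : e = c \/ xmax (f c) <= xmin (f e).
  by apply: (chain_side_rect pk chD Pc e0l el o1 o2 _ _ side); lra.
apply: IH.
- by move=> k kl; apply: below; rewrite inE kl orbT.
- exists e => //; split; [lra|lra|right].
  by case: Ee => [->|]; lra.
- lra.
- lra.
Qed.

(** To be applied with [D] the end square and [q] its transition point with the top square. [S1] and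
    [S2] meet along a horizontal line, [S1] above, with the piece to the left of [p]. *)
Lemma vertical_junction f P V D lD q S1 S2 p l1 l2 : packing f P V ->
  (forall i, P i -> 0 <= ymin (f i) \/ ymax (f i) <= 0) ->
  chain f P D lD -> xmin (f D) = q.1 -> ymin (f D) < q.2 <= ymax (f D) ->
  quadrant_in V false false q -> (forall u, V u -> u.2 < q.2) ->
  junction (@swap_rect R \o f) P (swap_set V) (swap p) S2 S1 ->
  p.1 < xmax (f S1) ->
  chain (@swap_rect R \o f) P S1 l1 -> chain (@swap_rect R \o f) P S2 l2 ->
  D = S1 \/ D = S2.
Proof.
move=> pk half chD xD yD qq Vq jn S1p ch1 ch2.
have pk' := packing_swap pk.
have PD := chain_valid chD (chain_mem chD).
have [P2 P1 /= yS2 yS1 xS2 xS1 [b qb]] := jn.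
have {}qb : quadrant_in V false b p.
  by have := quadrant_in_swap qb; rewrite /swap_set /swap /=; case: (p).
(* If [D] does not start left of [p], it touches the piece at [q] from beyond the junction. The
   degenerate outcome would make [S1] end at [p.1], against [S1p]. *)
have [xDp|xDp] := le_or_lt p.1 (xmin (f D)).
  have cq := closure_swap (quadrant_in_closure qq).
  have [||_ []] := junction_touching pk' jn ch2 ch1 PD cq; [split=> /=| |by right|by left|].
  - lra.
  - by have [] := packing_nondeg pk PD; lra.
  - by [].
  - by case=> _ _ /= h; exfalso; lra.
have [nD nD'] := packing_nondeg pk PD.
have VW : V `<=` west_of f lD.
  have d0 : 0 < q.2 - ymin (f D) by lra.
  have [s [t [hs ht Vu]]] := quadrant_in_near qq d0.
  apply: (all_west pk chD _ Vu); first by move=> u /Vq; lra.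
  by exists D; [exact: chain_mem chD|split => /=; rewrite /sg; lra].
have cp := quadrant_in_closure qb.
have pq : p.2 <= q.2.
  by apply: (closure_sub_closed (@closed_snd_le R q.2) _ cp) => u /Vq/ltW.
(* For [p] at a height of [D] below its top, [D] and [S1] both fill the northeast quadrant at [p].
   At the top of [D], points of [V] near [p] would lie above [q] or fail to be west of [D]. *)
have [pD|Dp] := lt_or_le p.2 (ymin (f D)); last first.
  have [pD|Dp'] := lt_or_le p.2 (ymax (f D)).
    left; apply: contrapT => DS.
    have := west_quadrant pk chD VW qb (chain_mem chD).
    rewrite Dp pD => /(_ isT) pxD.
    have [_ n1] := packing_nondeg pk P1.
    by move: (packing_disj pk PD P1 DS); clear - xDp Dp pD n1 S1p yS1 xS1 pxD; case; lra.
  have [d [d0 d1 d2]] : exists d : R, [/\ 0 < d, d <= p.1 - xmin (f D) & d <= p.2 - ymin (f D)].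
    exists (Num.min (p.1 - xmin (f D)) (p.2 - ymin (f D))).
    by rewrite lt_min !ge_min !lexx orbT; split=> //; lra.
  have [s [t [hs ht Vu]]] := quadrant_in_near qb d0.
  exfalso; have /= := west_ofP pk chD Vu (VW _ Vu) (chain_mem chD).
  have /= := Vq _ Vu; move: Vu; case: (b); rewrite /sg => Vu h; first by move=> _; lra.
  by move=> /(_ (ltac:(lra))); lra.
exfalso.
have p0 : 0 <= p.2 by case: (closure_pos pk cp).
have [|e el ey] := chain_cover pk chD p0; first by lra.
have Pe := chain_valid chD el.
have [ne ne'] := packing_nondeg pk Pe; have [n1 n1'] := packing_nondeg pk P1.
(* The enclosure, read in exchanged coordinates, says that [V] lies below the left chain of [S1], as
   the blocking argument requires. *)
apply: (left_chain_blocked pk half chD xD _ qq ch1).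
- lra.
- move=> k kl [x y] Vu ku; have {}Vu : swap_set V (y, x) by [].
  have [_ [_ w]] := junction_enclosure pk' jn ch2 ch1 Vu.
  exact: (west_ofP pk' ch1 Vu w kl ku).
- exists e => //; split; [lra|lra|].
  have [->|/eqP eS] := eqVneq e S1; first by left.
  have h := west_quadrant pk chD VW qb el ey.
  right; move: (packing_disj pk Pe P1 eS); clear - h ey yS1 xS1 S1p n1'.
  by case; lra.
- lra.
- lra.
Qed.

End Crossing.

(** * Boundary curves *)

Section Curve.
Variable R : realType.
Implicit Types (p q e : pt R).

Lemma continuous_at_eps (f : R -> R) (x eps : R) : {for x, continuous f} ->
  0 < eps -> exists2 d : R, 0 < d & forall y, `|y - x| < d -> `|f y - f x| < eps.
Proof.
move=> cf e0.
have /nbhs_ballP[d /= d0 dP] : nbhs x [set y | `|f y - f x| < eps].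
  have /cf : nbhs (f x) [set z : R | `|z - f x| < eps].
    by apply/nbhs_ballP; exists eps => // z; rewrite /ball /= distrC.
  by [].
by exists d => // y yx; apply: dP; rewrite /ball /= distrC.
Qed.

Lemma last_nonpositive (f : R -> R) (a b : R) : continuous f -> a < b ->
  f a <= 0 -> 0 < f b ->
  exists c, [/\ a <= c < b, f c = 0 & forall t, c < t <= b -> 0 < f t].
Proof.
move=> cf ab fa fb.
pose A : set R := [set t | a <= t <= b /\ f t <= 0].
have A0 : A !=set0 by exists a; split => //; lra.
have hA : has_sup A by split => //; exists b => t [/andP[]].
have ub t : A t -> t <= sup A by move=> At; apply: sup_upper_bound.
have aA : a <= sup A by apply: ub; split => //; lra.
have Ab : sup A <= b by apply: ge_sup => // t [/andP[]].
have pos t : sup A < t <= b -> 0 < f t.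
  move=> /andP[t1 t2]; have [//|ft] := lt_or_le 0 (f t).
  by have := ub t; rewrite /A /= => /(_ (conj (ltac:(lra)) ft)); lra.
have fs : f (sup A) <= 0.
  have [//|fs] := le_or_lt (f (sup A)) 0.
  have [d d0 dP] := continuous_at_eps (cf (sup A)) fs.
  have [t At tA] := sup_adherent d0 hA.
  have := ub t At; case: At => _ ft tA'.
  by have := dP t; rewrite !ltr_norml => /(_ (ltac:(lra))); lra.
have sb : sup A < b.
  by rewrite lt_neqAle Ab andbT; apply/eqP => sb; rewrite sb in fs; lra.
exists (sup A); split => //; first by rewrite aA.
have [fs0|fs0] := le_or_lt 0 (f (sup A)); first by lra.
have e0 : 0 < - f (sup A) by lra.
have [d d0 dP] := continuous_at_eps (cf (sup A)) e0.
pose t := Num.min (sup A + d / 2) b.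
have t1 : t <= sup A + d / 2 by rewrite ge_min lexx.
have t2 : t <= b by rewrite ge_min lexx orbT.
have t3 : sup A < t by rewrite lt_min; lra.
have := pos t; rewrite t2 t3 => /(_ isT) ft.
by have := dP t; rewrite !ltr_norml => /(_ (ltac:(lra))); lra.
Qed.

(** Coordinates relative to a unit vector [e]. The second one, [across], is positive to the right of
    [e], the side on which the circuit keeps the piece. *)
Definition along e p q : R := (q.1 - p.1) * e.1 + (q.2 - p.2) * e.2.
Definition across e p q : R := (q.1 - p.1) * e.2 - (q.2 - p.2) * e.1.
Definition shift p e (s t : R) : pt R :=
  (p.1 + s * e.1 + t * e.2, p.2 + s * e.2 - t * e.1).

Lemma along_continuous e p : continuous (along e p).
Proof.
move=> q; rewrite /along; apply: cvgD; apply: cvgM; try exact: cvg_cst.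
  by apply: cvgD; [exact: cvg_fst|exact: cvg_cst].
by apply: cvgD; [exact: cvg_snd|exact: cvg_cst].
Qed.

Lemma across_continuous e p : continuous (across e p).
Proof.
move=> q; rewrite /across; apply: cvgB; apply: cvgM; try exact: cvg_cst.
  by apply: cvgD; [exact: cvg_fst|exact: cvg_cst].
by apply: cvgD; [exact: cvg_snd|exact: cvg_cst].
Qed.

Lemma shiftE e p q : e.1 ^+ 2 + e.2 ^+ 2 = 1 ->
  q = shift p e (along e p q) (across e p q).
Proof.
case: e p q => [e1 e2] [p1 p2] [q1 q2]; rewrite /shift /along /across /= => he.
congr pair.
  have -> : p1 + ((q1 - p1) * e1 + (q2 - p2) * e2) * e1 +
     ((q1 - p1) * e2 - (q2 - p2) * e1) * e2 = p1 + (q1 - p1) * (e1 ^+ 2 + e2 ^+ 2) by ring.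
  by rewrite he; ring.
have -> : p2 + ((q1 - p1) * e1 + (q2 - p2) * e2) * e2 -
     ((q1 - p1) * e2 - (q2 - p2) * e1) * e1 = p2 + (q2 - p2) * (e1 ^+ 2 + e2 ^+ 2) by ring.
by rewrite he; ring.
Qed.

Lemma along_shift e p (s t : R) : e.1 ^+ 2 + e.2 ^+ 2 = 1 -> along e p (shift p e s t) = s.
Proof.
case: e p => [e1 e2] [p1 p2]; rewrite /shift /along /= => he.
have -> : (p1 + s * e1 + t * e2 - p1) * e1 + (p2 + s * e2 - t * e1 - p2) * e2 =
  s * (e1 ^+ 2 + e2 ^+ 2) by ring.
by rewrite he mulr1.
Qed.

(** After the last time with nonpositive first coordinate the path can only be on the half-axis. By
    continuity it is at [p] at that time, so by injectivity that time is 0. *)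
Lemma path_in_cross (g : R -> pt R) p e (tau s : R) : continuous g ->
  e.1 ^+ 2 + e.2 ^+ 2 = 1 -> 0 < tau -> 0 < s -> g 0 = p -> g tau = shift p e s 0 ->
  (forall t t', 0 <= t <= tau -> 0 <= t' <= tau -> g t = g t' -> t = t') ->
  (forall t, 0 <= t <= tau -> along e p (g t) = 0 \/ across e p (g t) = 0) ->
  forall t, 0 < t <= tau -> exists2 l, 0 < l <= 1 & g t = shift p e (l * s) 0.
Proof.
move=> cg he tau0 s0 g0 gt inj cross.
pose f t := along e p (g t); pose h t := across e p (g t).
have cf : continuous f.
  by move=> t; exact: (continuous_comp (cg t) (@along_continuous e p (g t))).
have ch : continuous h.
  by move=> t; exact: (continuous_comp (cg t) (@across_continuous e p (g t))).
have f0 : f 0 = 0 by rewrite /f g0 /along !subrr !mul0r addr0.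
have ft : f tau = s by rewrite /f gt along_shift.
have [||c [c1 fc pos]] := last_nonpositive cf tau0; [lra|lra|].
have h0 t : 0 <= t <= tau -> 0 < f t -> h t = 0.
  by move=> ht ft0; case: (cross t ht) => //; rewrite -/(f t); lra.
have c0 : c = 0.
  apply: inj; [lra|lra|]; rewrite g0 (shiftE p (g c) he) -/(f c) -/(h c) fc.
  suff -> : h c = 0 by rewrite /shift !mul0r !addr0 subr0; case: (p).
  have [//|/eqP hc] := eqVneq (h c) 0.
  have hc0 : 0 < `|h c| by rewrite normr_gt0; apply/eqP.
  have [d d0 dP] := continuous_at_eps (ch c) hc0.
  pose t := Num.min (c + d / 2) tau.
  have t1 : t <= c + d / 2 by rewrite ge_min lexx.
  have t2 : t <= tau by rewrite ge_min lexx orbT.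
  have t3 : c < t by rewrite lt_min; lra.
  have := dP t; rewrite ltr_norml => /(_ (ltac:(lra))).
  rewrite (h0 t); [|lra|by apply: pos; lra].
  by rewrite sub0r normrN ltxx.
move=> t /andP[t0 tt]; have ft0 : 0 < f t by apply: pos; lra.
(* Overshooting [s] would mean passing the endpoint of the path at an earlier time, against
   injectivity. *)
have ts : f t <= s.
  have [//|st] := le_or_lt (f t) s.
  have [||u] := @IVT R f 0 t s (ltW t0); first by apply: continuous_subspaceT.
    by rewrite f0 minEle maxEle (ltW ft0) (ltW s0) (ltW st).
  rewrite in_itv /= => /andP[u0 ut] fu.
  have ufu : 0 < f u by rewrite fu.
  suff : u = tau by move=> utau; have : f t = s by [rewrite (_ : t = tau) //; lra]; lra.
  apply: inj; [lra|lra|]; rewrite gt (shiftE p (g u) he) -/(f u) -/(h u) fu.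
  by rewrite h0 //; lra.
exists (f t / s); first by rewrite divr_gt0 //= ler_pdivrMr // mul1r.
rewrite divfK ?gt_eqF // [LHS](shiftE p _ he) -/(f t) -/(h t) h0 //; lra.
Qed.

Variables (gamma : R -> pt R).
Hypothesis gamma_cont : continuous gamma.
Hypothesis gamma_per : forall t, gamma (t + 1) = gamma t.
Hypothesis gamma_inj01 :
  forall t t', 0 <= t < 1 -> 0 <= t' < 1 -> gamma t = gamma t' -> t = t'.

Lemma periodic_int (z : int) t : gamma (t + z%:~R) = gamma t.
Proof.
have nat_per n u : gamma (u + n%:R) = gamma u.
  by elim: n u => [|n IH] u; rewrite ?addr0// -natr1 addrA gamma_per.
case: z => n; first by rewrite -pmulrn nat_per.
by rewrite NegzE mulrNz -pmulrn -[in RHS](subrK n.+1%:R t) nat_per.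
Qed.

Lemma gamma_inj t t' : `|t - t'| < 1 -> gamma t = gamma t' -> t = t'.
Proof.
move=> tt' gtt'.
have fr (x : R) : 0 <= x + (- Num.floor x)%:~R < 1.
  by have := Num.Theory.floor_itv x; rewrite mulrNz intrD => /andP[]; lra.
have := gamma_inj01 (fr t) (fr t'); rewrite !periodic_int => /(_ gtt').
move=> ett'; have e : t - t' = (Num.floor t - Num.floor t')%:~R.
  by move: ett'; rewrite !mulrNz intrB; lra.
move: tt'; rewrite e -intr_norm -[1]/(1%:~R) ltr_int => hz.
have : Num.floor t - Num.floor t' = 0 by lia.
by move=> ez; move: e; rewrite ez; lra.
Qed.

Lemma gamma_time (c t : R) : exists2 t', c <= t' < c + 1 & gamma t' = gamma t.
Proof.
exists (t + (- Num.floor (t - c))%:~R); last exact: periodic_int.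
by have := Num.Theory.floor_itv (t - c); rewrite mulrNz intrD => /andP[]; lra.
Qed.

(** Continuity of the inverse: within one period, the times at distance at least [d] from [t0] form
    a compact set, whose image is closed and misses [gamma t0]. *)
Lemma gamma_near (t0 d : R) : 0 < d -> exists2 eta : R, 0 < eta &
  forall t, `|(gamma t).1 - (gamma t0).1| < eta -> `|(gamma t).2 - (gamma t0).2| < eta ->
  exists2 t', gamma t' = gamma t & `|t' - t0| < d.
Proof.
move=> d0.
pose K : set R := `[t0 - 1/2, t0 - d] `|` `[t0 + d, t0 + 1/2].
have cK : closed (gamma @` K).
  apply: compact_closed; first exact: norm_hausdorff.
  apply: continuous_compact; first exact: continuous_subspaceT.
  by apply: compactU; exact: segment_compact.
have nK : (~` (gamma @` K)) (gamma t0).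
  move=> [t Kt gt]; have : t = t0.
    by apply: gamma_inj => //; case: Kt => /=; rewrite in_itv /= ltr_norml; lra.
  by case: Kt => /=; rewrite in_itv /=; lra.
have /pt_nbhsP[eta eta0 etaP] : nbhs (gamma t0) (~` (gamma @` K)).
  by apply: open_nbhs_nbhs; split => //; exact: closed_openC.
exists eta => // t h1 h2.
have [t' ht' gt'] := gamma_time (t0 - 1/2) t.
exists t' => //; have [//|dt'] := lt_or_le `|t' - t0| d.
case: (etaP (gamma t)) => //; exists t' => //.
by move: dt'; rewrite ler_normr => /orP[h|h]; [right|left]; rewrite /= in_itv /=; lra.
Qed.

End Curve.

(** * Orientation of the curve along a half-axis *)

Section Arm.
Variable R : realType.
Implicit Types (p q e : pt R) (U B : set (pt R)).

Definition keeps_on_right (gamma : R -> pt R) U : Prop :=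
  forall t0 t1, t0 < t1 -> gamma t0 <> gamma t1 ->
    (forall t, t0 <= t <= t1 -> exists l : R, (0 <= l <= 1) /\
       gamma t = ((gamma t0).1 + l * ((gamma t1).1 - (gamma t0).1),
                  (gamma t0).2 + l * ((gamma t1).2 - (gamma t0).2))) ->
    let d := ((gamma t1).1 - (gamma t0).1, (gamma t1).2 - (gamma t0).2) in
    let mid := (((gamma t0).1 + (gamma t1).1) / 2,
                ((gamma t0).2 + (gamma t1).2) / 2) in
    exists del : R, 0 < del /\ forall eps : R, 0 < eps < del ->
      U (mid.1 + eps * d.2, mid.2 - eps * d.1).

Record clockwise_curve (gamma : R -> pt R) U B : Prop := ClockwiseCurve {
  curve_cont : continuous gamma;
  curve_per : forall t, gamma (t + 1) = gamma t;
  curve_inj : forall t t', 0 <= t < 1 -> 0 <= t' < 1 -> gamma t = gamma t' -> t = t';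
  curve_image : forall q, B q <-> exists t, gamma t = q;
  curve_right : keeps_on_right gamma U }.

Lemma keeps_on_right_segment gamma U (t0 t1 a c : R) p e : keeps_on_right gamma U ->
  e.1 ^+ 2 + e.2 ^+ 2 = 1 -> t0 < t1 -> a <> c ->
  gamma t0 = shift p e a 0 -> gamma t1 = shift p e c 0 ->
  (forall t, t0 <= t <= t1 -> exists2 l, 0 <= l <= 1 &
     gamma t = shift p e (a + l * (c - a)) 0) ->
  forall d : R, 0 < d ->
    exists2 eps, 0 < eps < d & U (shift p e ((a + c) / 2) (eps * (c - a))).
Proof.
move=> gR he tt ac g0 g1 seg d d0.
have [||del [del0 delU]] := gR t0 t1 tt.
- by rewrite g0 g1 => /(congr1 (along e p)); rewrite !along_shift.
- move=> t /seg[l hl gt]; exists l; split=> //.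
  by rewrite g0 g1 gt /shift /=; congr pair; ring.
have m0 : 0 < Num.min del d by rewrite lt_min del0.
have md : Num.min del d <= d by rewrite ge_min lexx orbT.
have mdel : Num.min del d <= del by rewrite ge_min lexx.
exists (Num.min del d / 2); first by clear - m0 md; lra.
have := delU (Num.min del d / 2) (ltac:(clear - m0 mdel; lra)).
rewrite g0 g1 /shift /=; set P := (_, _); set Q := (_, _).
by suff -> : P = Q by []; rewrite /P /Q; congr pair; field.
Qed.

(* The points [shift p e s (- sg sigma * t)] lie to the left of the half-axis if
   [sigma = true] and to its right if [sigma = false]; accordingly the curve
   follows the half-axis just after, or just before, [t0]. *)
Lemma curve_follows_axis gamma U B (t0 : R) p e (r : R) (sigma : bool) :
  clockwise_curve gamma U B -> gamma t0 = p ->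
  e.1 ^+ 2 + e.2 ^+ 2 = 1 -> `|e.1| <= 1 -> `|e.2| <= 1 -> 0 < r ->
  (forall q, B q -> `|q.1 - p.1| < r -> `|q.2 - p.2| < r ->
     along e p q = 0 \/ across e p q = 0) ->
  (forall s, 0 < s < r -> B (shift p e s 0)) ->
  (forall s t, 0 < s < r -> 0 < t < r -> ~ U (shift p e s (- sg R sigma * t))) ->
  exists2 d : R, 0 < d & forall t, 0 < t < d ->
    exists2 s, 0 < s < r & gamma (t0 + sg R sigma * t) = shift p e s 0.
Proof.
move=> [gc gp gi gB gR] gt0 he e1 e2 r0 H1 H2 H3.
have [d1 [d10 d12 d1P]] : exists d : R, [/\ 0 < d, d <= 1/2 & forall t, `|t - t0| < d ->
    `|(gamma t).1 - p.1| < r /\ `|(gamma t).2 - p.2| < r].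
  have c1 : {for t0, continuous (fun t => (gamma t).1)}.
    by apply: continuous_comp; [exact: gc|exact: cvg_fst].
  have c2 : {for t0, continuous (fun t => (gamma t).2)}.
    by apply: continuous_comp; [exact: gc|exact: cvg_snd].
  have [a a0 aP] := continuous_at_eps c1 r0; have [b b0 bP] := continuous_at_eps c2 r0.
  exists (Num.min (Num.min a b) (1/2)).
  split; [rewrite !lt_min a0 b0 /=; lra|by rewrite ge_min lexx orbT|].
  move=> t; rewrite !lt_min => /andP[/andP[ta tb] _].
  by have := aP t ta; have := bP t tb; rewrite gt0 => /= h1 h2; split.
have [eta eta0 etaP] := gamma_near gc gp gi t0 d10; rewrite gt0 in etaP.
pose s1 := Num.min r eta / 2.
have m0 : 0 < Num.min r eta by rewrite lt_min r0.
have mr : Num.min r eta <= r by rewrite ge_min lexx.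
have me : Num.min r eta <= eta by rewrite ge_min lexx orbT.
have s10 : 0 < s1 by rewrite /s1; lra.
have s1r : s1 < r by rewrite /s1; lra.
have s1e : s1 < eta by rewrite /s1; lra.
have [tau' tau'E] := (gB _).1 (H2 s1 (ltac:(lra))).
have small (x : R) : `|x| <= 1 -> `|s1 * x| < eta.
  move=> x1; apply: le_lt_trans s1e; rewrite normrM (gtr0_norm s10).
  by rewrite ler_piMr // ltW.
have [||tau] := etaP tau'; rewrite ?tau'E /shift /=.
- by rewrite mul0r addr0 addrAC subrr add0r; exact: small.
- by rewrite mul0r subr0 addrAC subrr add0r; exact: small.
rewrite -[(_, _)]/(shift p e s1 0) => tauE taud.
have shift0 : shift p e 0 0 = p by rewrite /shift !mul0r !addr0 subr0; case: (p).
have pq : shift p e s1 0 <> p.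
  move=> /(congr1 (along e p)); rewrite along_shift //.
  by rewrite /along !subrr !mul0r addr0; lra.
have s1n0 : s1 <> 0 by move=> h; rewrite h ltxx in s10.
have gt0s : gamma t0 = shift p e 0 0 by rewrite gt0 shift0.
have scaled (l : R) : 0 < l <= 1 -> 0 < l * s1 < r.
  move=> /andP[l0 l1]; rewrite mulr_gt0 //=; apply: le_lt_trans s1r.
  by rewrite ler_piMl // ltW.
have walk (c x : R) : c = 1 \/ c = -1 -> tau = t0 + c * x -> 0 < x ->
    forall t, 0 < t <= x -> exists2 l, 0 < l <= 1 &
      gamma (t0 + c * t) = shift p e (l * s1) 0.
  move=> hc ctau x0.
  have xd : x < d1.
    by move: taud; rewrite ctau ltr_norml; clear - hc; case: hc => ->; lra.
  apply: (@path_in_cross _ (fun t => gamma (t0 + c * t))) => //.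
  - move=> t; apply: (@continuous_comp _ _ _ (fun t => t0 + c * t) gamma); last exact: gc.
    by apply: cvgD; [exact: cvg_cst|apply: cvgM; [exact: cvg_cst|exact: cvg_id]].
  - by rewrite mulr0 addr0.
  - by rewrite -ctau tauE.
  - move=> t t' ht ht' /(gamma_inj gp gi) => hh.
    have : t0 + c * t = t0 + c * t'.
      by apply: hh; rewrite ltr_norml; clear - hc ht ht' xd d12; case: hc => ->; lra.
    by clear - hc; case: hc => ->; lra.
  - move=> t ht; have [|h1 h2] := d1P (t0 + c * t).
      by rewrite ltr_norml; clear - hc ht xd; case: hc => ->; lra.
    by apply: H1 => //; apply/gB; exists (t0 + c * t).
have [tt|tt|tt] := ltgtP tau t0; last by rewrite tt gt0 in tauE; case: pq.
(* Here the curve comes in along the half-axis. Its right-hand side is the left of [e], so for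
   [sigma = true] points of [U] would appear where there are none; the other case is symmetric. *)
- have wk := walk (-1) (t0 - tau) (or_intror erefl) (ltac:(clear; lra)) (ltac:(clear - tt; lra)).
  case: sigma H3 => H3; last first.
    exists (t0 - tau); first by rewrite subr_gt0.
    move=> t /andP[ht ht']; have [|l hl gl] := wk t; first by rewrite ht ltW.
    by exists (l * s1); [exact: scaled|rewrite /sg gl].
  have seg t : tau <= t <= t0 -> exists2 l, 0 <= l <= 1 &
      gamma t = shift p e (s1 + l * (0 - s1)) 0.
    move=> /andP[ht ht']; move: ht'; rewrite le_eqVlt => /predU1P[->|ht'].
      by exists 1; [rewrite ler01 lexx|rewrite mul1r sub0r subrr shift0].
    have [|l hl gl] := wk (t0 - t); first by rewrite subr_gt0 ht' lerB.
    exists (1 - l); first by clear - hl; lra.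
    rewrite mulN1r opprB subrKC in gl.
    by rewrite gl; congr (shift p e _ 0); ring.
  have [eps heps] := keeps_on_right_segment gR he tt s1n0 tauE gt0s seg ltr01.
  have [es es'] := andP (scaled eps (ltac:(clear - heps; lra))).
  rewrite sub0r mulrN addr0 => Uz; exfalso; apply: (H3 (s1 / 2) (eps * s1)).
  - by clear - s10 s1r; lra.
  - by rewrite es es'.
  - by rewrite /sg mulN1r.
- have wk := walk 1 (tau - t0) (or_introl erefl) (ltac:(clear; lra)) (ltac:(clear - tt; lra)).
  case: sigma H3 => H3.
    exists (tau - t0); first by rewrite subr_gt0.
    move=> t /andP[ht ht']; have [|l hl gl] := wk t; first by rewrite ht ltW.
    by exists (l * s1); [exact: scaled|rewrite /sg gl].
  have seg t : t0 <= t <= tau -> exists2 l, 0 <= l <= 1 &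
      gamma t = shift p e (0 + l * (s1 - 0)) 0.
    move=> /andP[ht ht']; move: ht; rewrite le_eqVlt => /predU1P[<-|ht].
      by exists 0; [rewrite ler01 lexx|rewrite mul0r addr0 gt0 shift0].
    have [|l hl gl] := wk (t - t0); first by rewrite subr_gt0 ht lerB.
    exists l; first by clear - hl; lra.
    rewrite mul1r subrKC in gl.
    by rewrite gl add0r subr0.
  have [eps heps] := keeps_on_right_segment gR he tt (nesym s1n0) gt0s tauE seg ltr01.
  have [es es'] := andP (scaled eps (ltac:(clear - heps; lra))).
  rewrite subr0 add0r => Uz; exfalso; apply: (H3 (s1 / 2) (eps * s1)).
  - by clear - s10 s1r; lra.
  - by rewrite es es'.
  - by rewrite /sg opprK mul1r.
Qed.

End Arm.

(** * Quadrants at the end of an arc *)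

Section Corner.
Variables (R : realType) (I : eqType).
Implicit Types (f : I -> rect R) (P : I -> Prop) (U V B : set (pt R)) (p q : pt R).

Lemma quadrant_free f P V i a b p : packing f P V -> P i ->
  quadrant_in V a b p -> ~ in_quadrant (f i) a b p.
Proof.
move=> pk Pi q [hx hy].
have [d [d0 d1 d2]] : exists d : R, [/\ 0 < d,
    d <= (if a then xmax (f i) - p.1 else p.1 - xmin (f i)) &
    d <= (if b then ymax (f i) - p.2 else p.2 - ymin (f i))].
  eexists (Num.min (if a then xmax (f i) - p.1 else p.1 - xmin (f i))
                   (if b then ymax (f i) - p.2 else p.2 - ymin (f i))).
  rewrite lt_min !ge_min !lexx orbT; split=> //; apply/andP; split.
    by case: (a) hx; lra.
  by case: (b) hy; lra.
have [s [t [hs ht Vu]]] := quadrant_in_near q d0.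
apply: (packing_free pk Pi Vu); split; rewrite /sg /=.
  by case: (a) hx d1 => hx d1; lra.
by case: (b) hy d2 => hy d2; lra.
Qed.

Lemma in_quadrant_inj f P V i j a b p : packing f P V -> P i -> P j ->
  in_quadrant (f i) a b p -> in_quadrant (f j) a b p -> i = j.
Proof.
move=> pk Pi Pj [ix iy] [jx jy]; apply: contrapT => ij.
by case: (packing_disj pk Pi Pj ij); case: (a) ix jx; case: (b) iy jy; lra.
Qed.

Lemma interior_free f P V i q : packing f P V -> P i -> closure V q ->
  xmin (f i) < q.1 < xmax (f i) -> ymin (f i) < q.2 < ymax (f i) -> False.
Proof.
move=> pk Pi cq hx hy.
have [d [d0 d1 d2 d3 d4]] : exists d : R, [/\ 0 < d, d <= xmax (f i) - q.1, d <= q.1 - xmin (f i),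
    d <= ymax (f i) - q.2 & d <= q.2 - ymin (f i)].
  exists (Num.min (Num.min (xmax (f i) - q.1) (q.1 - xmin (f i)))
                  (Num.min (ymax (f i) - q.2) (q.2 - ymin (f i)))).
  by rewrite !lt_min !ge_min !lexx !orbT; split=> //; lra.
have /pt_closureP/(_ _ d0)[u [Vu]] := cq; rewrite !ltr_norml => u1 u2.
by apply: (packing_free pk Pi Vu); split; lra.
Qed.

(** Applied to all edges, this makes the box of radius [r] around a point so small that each
    rectangle meeting the interior of a quadrant of the box contains that whole quadrant. *)
Definition off_by (c x r : R) := [\/ c = x, c <= x - r | x + r <= c].

Lemma off_by_le c x r r' : r' <= r -> off_by c x r -> off_by c x r'.
Proof. by move=> rr []; [apply: Or31|move=> h; apply: Or32; lra|move=> h; apply: Or33; lra]. Qed.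

Lemma off_by_ex c x : exists2 r, 0 < r & off_by c x r.
Proof.
have [h|h|->] := ltgtP c x.
- by exists (x - c); [lra|apply: Or32; lra].
- by exists (c - x); [lra|apply: Or33; lra].
- by exists 1 => //; apply: Or31.
Qed.

Definition clear_radius (S : rect R) p r : Prop :=
  (off_by (xmin S) p.1 r /\ off_by (xmax S) p.1 r) /\
  (off_by (ymin S) p.2 r /\ off_by (ymax S) p.2 r).

Lemma clear_radius_le S p r r' : r' <= r -> clear_radius S p r -> clear_radius S p r'.
Proof. by move=> rr [[h1 h2] [h3 h4]]; do 2?split; apply: off_by_le rr _. Qed.

Lemma clear_radius_ex f (C : seq I) p (r0 : R) : 0 < r0 ->
  exists r, [/\ 0 < r, r <= r0 & forall i, i \in C -> clear_radius (f i) p r].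
Proof.
move=> r00; elim: C => [|i C [r [rpos rr IH]]]; first by exists r0.
have [a a0 ha] := off_by_ex (xmin (f i)) p.1.
have [b b0 hb] := off_by_ex (xmax (f i)) p.1.
have [c c0 hc] := off_by_ex (ymin (f i)) p.2.
have [d d0 hd] := off_by_ex (ymax (f i)) p.2.
pose m := Num.min r (Num.min (Num.min a b) (Num.min c d)).
have mr : m <= r by rewrite /m !ge_min lexx.
have ma : m <= a by rewrite /m !ge_min lexx !orbT.
have mb : m <= b by rewrite /m !ge_min lexx !orbT.
have mc : m <= c by rewrite /m !ge_min lexx !orbT.
have md : m <= d by rewrite /m !ge_min lexx !orbT.
exists m; split; [by rewrite !lt_min rpos a0 b0 c0 d0|exact: le_trans rr|].
move=> j; rewrite inE => /predU1P[->|jC]; last by apply: clear_radius_le mr _; exact: IH.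
split; split; [exact: off_by_le ha|exact: off_by_le hb|exact: off_by_le hc|exact: off_by_le hd].
Qed.

Lemma off_by_lt c x y r : off_by c x r -> `|y - x| < r -> y <> x -> c <= y -> c < y.
Proof.
move=> h; rewrite ltr_norml => yx ne; rewrite le_eqVlt => /predU1P[cy|//].
by case: h ne; rewrite cy => h // _; lra.
Qed.

Lemma off_by_gt c x y r : off_by c x r -> `|y - x| < r -> y <> x -> y <= c -> y < c.
Proof.
move=> h; rewrite ltr_norml => yx ne; rewrite le_eqVlt => /predU1P[cy|//].
by case: h ne; rewrite -cy => h // _; lra.
Qed.

Lemma arcs_cover (b : nat -> R) (i n : nat) t : (i < n)%N -> b i <= t <= b n ->
  exists j, [/\ (i <= j)%N, (j < n)%N & b j <= t <= b j.+1].
Proof.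
elim: n => // n IH; rewrite ltnS leq_eqVlt => /predU1P[->|ilt] /andP[ht1 ht2].
  by exists n; rewrite leqnn ht1 ht2.
have [h|h] := le_or_lt t (b n).
  by have [|j [j1 j2 jt]] := IH ilt; [rewrite ht1|exists j; rewrite j1 ltnW].
by exists n; rewrite ltnW // ht2 (ltW h).
Qed.

Lemma arcs_mono (b : nat -> R) (m : nat) : (forall i, (i < m)%N -> b i <= b i.+1) ->
  forall i j, (i <= j)%N -> (j <= m)%N -> b i <= b j.
Proof.
move=> mono i; elim=> [|j IH]; first by rewrite leqn0 => /eqP->.
rewrite leq_eqVlt => /predU1P[->//|ij] jm.
by apply: le_trans (IH ij (ltnW jm)) _; exact: mono.
Qed.

(** [U] is the piece, [V] its open part and [B] the boundary. [circuit_outside] concerns [U] because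
    [keeps_on_right] provides points of [U], possibly on a wall or on the floor. *)
Record circuit f P U V B (gamma : R -> pt R) (C : seq I) (x0 : I) (b : nat -> R) : Prop :=
  Circuit {
  circuit_curve : clockwise_curve gamma U B;
  circuit_packing : packing f P V;
  circuit_boundary : forall p, B p <-> closure V p /\ ~ V p;
  circuit_valid : forall i, i \in C -> P i;
  circuit_outside : forall i q, P i -> U q ->
    xmin (f i) < q.1 < xmax (f i) -> ~ ymin (f i) < q.2 < ymax (f i);
  circuit_uniq : uniq C;
  circuit_mono : forall i, (i < size C)%N -> b i <= b i.+1;
  circuit_closes : b (size C) = b 0 + 1;
  circuit_arc : forall i, (i < size C)%N -> forall t, b i <= t <= b i.+1 ->
    in_rect (f (nth x0 C i)) (gamma t) }.

Lemma circuit_point f P U V B gamma C x0 b : circuit f P U V B gamma C x0 b ->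
  forall q, B q -> exists2 i, i \in C & in_rect (f i) q.
Proof.
move=> ct q /(curve_image (circuit_curve ct))[t <-].
have [gc gp gi gB gR] := circuit_curve ct.
have [t' ht' <-] := gamma_time gp (b 0) t.
have C0 : (0 < size C)%N.
  rewrite lt0n; apply/eqP => C0; have := circuit_closes ct; rewrite C0; lra.
have [|j [_ jm jt]] := @arcs_cover b 0 (size C) t' C0.
  by rewrite (circuit_closes ct); lra.
by exists (nth x0 C j); [exact: mem_nth|exact: (circuit_arc ct)].
Qed.

(** The times considered fill the complement of arc [j] in one period, entered at its end or, going
    backwards, at its start; periodicity takes care of the wrap-around. *)
Lemma other_arc f P U V B gamma C x0 b j (sigma : bool) :
  circuit f P U V B gamma C x0 b -> (j < size C)%N -> b j.+1 < b j + 1 ->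
  forall t, 0 < t < b j + 1 - b j.+1 -> exists2 i, i \in C &
    i <> nth x0 C j /\
    in_rect (f i) (gamma ((if sigma then b j.+1 else b j) + sg R sigma * t)).
Proof.
move=> ct jm jb t ht.
have [gc gp gi gB gR] := circuit_curve ct.
have mono := arcs_mono (circuit_mono ct).
have b0j := mono 0 j (leq0n _) (ltnW jm); have bjm := mono _ _ jm (leqnn _).
have bl := circuit_closes ct.
have fin i t' : (i < size C)%N -> i <> j -> b i <= t' <= b i.+1 ->
    exists2 k, k \in C & k <> nth x0 C j /\ in_rect (f k) (gamma t').
  move=> im ij it'; exists (nth x0 C i); first exact: mem_nth.
  split; last exact: (circuit_arc ct).
  by move/eqP; rewrite nth_uniq ?(circuit_uniq ct)// => /eqP.
suff after t' : b j.+1 < t' < b j + 1 ->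
    exists2 k, k \in C & k <> nth x0 C j /\ in_rect (f k) (gamma t').
  case: sigma; rewrite /sg; first by apply: after; lra.
  by rewrite -gp; apply: after; lra.
move=> ht'; have [h|h] := le_or_lt t' (b (size C)).
  have jS : (j.+1 < size C)%N.
    rewrite ltn_neqAle jm andbT; apply/eqP => js; rewrite js in ht'; lra.
  have [|i [ji im it']] := @arcs_cover b j.+1 (size C) t' jS; first by lra.
  by apply: (fin i) => // ij; rewrite ij ltnn in ji.
have j0 : (0 < j)%N.
  by rewrite lt0n; apply/eqP => j0; rewrite j0 in ht'; lra.
rewrite -(subrK 1 t') gp.
have [|i [ji im it']] := @arcs_cover b 0 j (t' - 1) j0; first by lra.
by apply: (fin i) => //; [exact: ltn_trans jm|move=> ij; rewrite ij ltnn in im].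
Qed.

Definition in_side (lo hi : R) (a : bool) x := if a then lo <= x < hi else lo < x <= hi.

Lemma in_side_lt lo hi a x s r : off_by lo x r -> off_by hi x r -> 0 < s < r ->
  in_side lo hi a x -> lo < x + sg R a * s < hi.
Proof. by rewrite /in_side /sg; case: a => -[h1|h1|h1] [h2|h2|h2] hs h; lra. Qed.

Lemma in_side_of lo hi a x s r : off_by lo x r -> off_by hi x r -> 0 < s < r ->
  lo <= x + sg R a * s <= hi -> in_side lo hi a x.
Proof. by rewrite /in_side /sg; case: a => -[h1|h1|h1] [h2|h2|h2] hs h; lra. Qed.

Lemma in_side_le lo hi a x : in_side lo hi a x -> lo <= x <= hi.
Proof. by rewrite /in_side; case: a => h; lra. Qed.

Lemma in_side_ex lo hi a x : lo < hi -> lo <= x <= hi ->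
  in_side lo hi a x \/ in_side lo hi (~~ a) x.
Proof.
move=> lohi hx; have [h|h] := lt_or_le x hi.
  have [h'|h'] := lt_or_le lo x; case: a; rewrite /in_side /=; [left|left|left|right]; lra.
by case: a; rewrite /in_side /=; [right|left]; lra.
Qed.

(* The half-axis between the quadrant [(qa, qb)] and its counterclockwise
   ([sigma = true]) or clockwise ([sigma = false]) neighbour. *)
Definition corner_axis (sigma qa qb : bool) : pt R :=
  ((sg R qa - sg R sigma * sg R qb) / 2, (sg R qb + sg R sigma * sg R qa) / 2).

Lemma corner_axisP (sigma qa qb : bool) :
  let sa := if sigma then ~~ qb else qb in let sb := if sigma then qa else ~~ qa in
  (corner_axis sigma qa qb = (0, sg R qb) /\
     [/\ sa = ~~ qa, sb = qb & - sg R sigma * sg R qb = sg R (~~ qa)]) \/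
  (corner_axis sigma qa qb = (sg R qa, 0) /\
     [/\ sa = qa, sb = ~~ qb & sg R sigma * sg R qa = sg R (~~ qb)]).
Proof.
rewrite /corner_axis; case: sigma; case: qa; case: qb; rewrite /sg /=;
  [left|right|right|left|right|left|left|right];
  (split; [congr pair; lra|split => //; lra]).
Qed.

(* Otherwise the curve would leave ([sigma = true]) or reach ([sigma = false]) the
   corner along the axis separating the two quadrants, hence within [C_j]. *)
Lemma arc_end_quadrant f P U V B gamma C x0 b j (sigma : bool) p (qa qb : bool) :
  circuit f P U V B gamma C x0 b -> (j < size C)%N -> b j.+1 < b j + 1 ->
  gamma (if sigma then b j.+1 else b j) = p -> quadrant_in V qa qb p ->
  ~ in_quadrant (f (nth x0 C j)) (if sigma then ~~ qb else qb)
                                 (if sigma then qa else ~~ qa) p.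
Proof.
move=> ct jm jb gp Vq Sq.
have pk := circuit_packing ct.
pose S := nth x0 C j.
have SC : S \in C by exact: mem_nth.
have PS : P S := circuit_valid ct SC.
have [r0 r00 r0V] := Vq.
have [r [rpos rr clear]] := clear_radius_ex f C p r00.
(* Near [p] the boundary lies on the cross through [p]: off it, a boundary point would be interior
   to a rectangle of [C], which keeps away from the closure of [V]. *)
have H1 q : B q -> `|q.1 - p.1| < r -> `|q.2 - p.2| < r -> q.1 = p.1 \/ q.2 = p.2.
  move=> Bq q1 q2; have [?|/eqP n1] := eqVneq q.1 p.1; first by left.
  have [?|/eqP n2] := eqVneq q.2 p.2; first by right.
  have [cq _] := (circuit_boundary ct q).1 Bq.
  have [i iC [/andP[ix1 ix2] /andP[iy1 iy2]]] := circuit_point ct Bq.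
  have [[c1 c2] [c3 c4]] := clear i iC.
  case: (interior_free pk (circuit_valid ct iC) cq).
    by rewrite (off_by_lt c1 q1 n1 ix1) (off_by_gt c2 q1 n1 ix2).
  by rewrite (off_by_lt c3 q2 n2 iy1) (off_by_gt c4 q2 n2 iy2).
have [[cS1 cS2] [cS3 cS4]] := clear S SC.
have [Sx Sy] :
    in_side (xmin (f S)) (xmax (f S)) (if sigma then ~~ qb else qb) p.1 /\
    in_side (ymin (f S)) (ymax (f S)) (if sigma then qa else ~~ qa) p.2 by [].
pose e := corner_axis sigma qa qb.
(* A rectangle meeting the open half-axis fills one of the two quadrants beside it. One of them
   belongs to [V], the other to [S]. *)
have unique i s : i \in C -> 0 < s < r -> in_rect (f i) (shift p e s 0) -> i = S.
  move=> iC hs [zx zy]; have Pi := circuit_valid ct iC.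
  have [[c1 c2] [c3 c4]] := clear i iC; have [nx ny] := packing_nondeg pk Pi.
  have nV := quadrant_free pk Pi Vq.
  apply: (in_quadrant_inj pk Pi PS _ Sq).
  move: zx zy; rewrite /shift /e.
  case: (corner_axisP sigma qa qb) => -[-> [-> -> _]] /=;
    rewrite !(mul0r, mulr0, addr0, subr0) [s * _]mulrC => zx zy.
    have iy := in_side_of c3 c4 hs zy.
    by case: (in_side_ex qa nx zx) => ix; split=> //; case: nV.
  have ix := in_side_of c1 c2 hs zx.
  by case: (in_side_ex qb ny zy) => iy; split=> //; case: nV.
have axis s : 0 < s < r -> B (shift p e s 0).
  move=> hs; apply/(circuit_boundary ct).
  have hs0 : 0 < s < r0 by lra.
  have := in_side_le Sy; have := in_side_le Sx; move: Sx Sy; rewrite /e /shift.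
  case: (corner_axisP sigma qa qb) => -[-> [-> -> _]] /=;
    rewrite !(mul0r, mulr0, addr0, subr0) [s * _]mulrC => Sx Sy Sx' Sy'.
    split; last first.
      move=> Vz; apply: (packing_free pk PS Vz); split => //=.
      by have := in_side_lt cS3 cS4 hs Sy => /andP[/ltW-> /ltW->].
    apply/pt_closureP => d d0; pose t := Num.min d r0 / 2.
    have t0 : 0 < Num.min d r0 by rewrite lt_min d0.
    have t1 : Num.min d r0 <= d by rewrite ge_min lexx.
    have t2 : Num.min d r0 <= r0 by rewrite ge_min lexx orbT.
    exists (p.1 + sg R qa * t, p.2 + sg R qb * s); split => /=.
    - by apply: r0V => //; rewrite /t; lra.
    - by rewrite ltr_norml /t /sg; case: (qa); lra.
    - by rewrite subrr normr0.
  split; last first.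
    move=> Vz; apply: (packing_free pk PS Vz); split => //=.
    by have := in_side_lt cS1 cS2 hs Sx => /andP[/ltW-> /ltW->].
  apply/pt_closureP => d d0; pose t := Num.min d r0 / 2.
  have t0 : 0 < Num.min d r0 by rewrite lt_min d0.
  have t1 : Num.min d r0 <= d by rewrite ge_min lexx.
  have t2 : Num.min d r0 <= r0 by rewrite ge_min lexx orbT.
  exists (p.1 + sg R qa * s, p.2 + sg R qb * t); split => /=.
  - by apply: r0V => //; rewrite /t; lra.
  - by rewrite subrr normr0.
  - by rewrite ltr_norml /t /sg; case: (qb); lra.
have far s t : 0 < s < r -> 0 < t < r -> ~ U (shift p e s (- sg R sigma * t)).
  move=> hs ht Uz.
  have := in_side_lt cS1 cS2 _ Sx; have := in_side_lt cS3 cS4 _ Sy.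
  have := circuit_outside ct PS Uz; rewrite /shift /e.
  case: (corner_axisP sigma qa qb) => -[-> [-> -> esg]] /=.
    have -> : p.1 + s * 0 + - sg R sigma * t * sg R qb = p.1 + sg R (~~ qa) * t.
      by rewrite -esg; ring.
    have -> : p.2 + s * sg R qb - - sg R sigma * t * 0 = p.2 + sg R qb * s by ring.
    by move=> h /(_ s hs) hy /(_ t ht) hx; exact: h hx hy.
  have -> : p.1 + s * sg R qa + - sg R sigma * t * 0 = p.1 + sg R qa * s by ring.
  have -> : p.2 + s * 0 - - sg R sigma * t * sg R qa = p.2 + sg R (~~ qb) * t.
    by rewrite -esg; ring.
  by move=> h /(_ t ht) hy /(_ s hs) hx; exact: h hx hy.
have cross q : B q -> `|q.1 - p.1| < r -> `|q.2 - p.2| < r ->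
    along e p q = 0 \/ across e p q = 0.
  move=> Bq q1 q2; rewrite /along /across /e.
  case: (corner_axisP sigma qa qb) => -[-> _] /=;
    by case: (H1 q Bq q1 q2) => ->; rewrite subrr !(mul0r, mulr0, addr0, subr0); auto.
have [e1 e2 ee] : [/\ `|e.1| <= 1, `|e.2| <= 1 & e.1 ^+ 2 + e.2 ^+ 2 = 1].
  rewrite /e; case: (corner_axisP sigma qa qb) => -[-> _] /=;
  rewrite /sg; [case: (qb)|case: (qa)];
  by rewrite ?normrN ?normr1 ?normr0 ?sqrrN ?expr1n ?expr0n ?addr0 ?add0r; split.
have [d d0 dP] := curve_follows_axis (circuit_curve ct) gp ee e1 e2 rpos cross axis far.
pose t := Num.min d (b j + 1 - b j.+1) / 2.
have t0 : 0 < Num.min d (b j + 1 - b j.+1) by rewrite lt_min d0; lra.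
have t1 : Num.min d (b j + 1 - b j.+1) <= d by rewrite ge_min lexx.
have t2 : Num.min d (b j + 1 - b j.+1) <= (b j + 1 - b j.+1) by rewrite ge_min lexx orbT.
(* A time outside arc [j] at which the curve is still on the half-axis: another square of [C]
   contains that point, against [unique]. *)
have [|s hs gs] := dP t; first by rewrite /t; lra.
have [|i iC [iS]] := other_arc sigma ct jm jb (t := t); first by rewrite /t; lra.
by rewrite gs => /(unique i s iC hs).
Qed.

End Corner.

(** * Topology of the pieces *)

Section Pieces.
Variable R : realType.
Implicit Types (p q u : pt R) (U V B : set (pt R)).

Definition near_pt p (r : R) q := `|q.1 - p.1| < r /\ `|q.2 - p.2| < r.

Definition on_segment u v (l : R) : pt R :=
  (u.1 + l * (v.1 - u.1), u.2 + l * (v.2 - u.2)).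

Lemma on_segment_continuous u v : continuous (on_segment u v).
Proof.
have aff (a c : R) : continuous (fun l : R => a + l * c).
  by move=> l; apply: cvgD; [exact: cvg_cst|apply: cvgM; [exact: cvg_id|exact: cvg_cst]].
by move=> l; exact: (cvg_pair (aff _ _ l) (aff _ _ l)).
Qed.

Lemma segment_set_connected u v : connected (on_segment u v @` `[0, 1]).
Proof.
apply: connected_continuous_connected; first exact: segment_connected.
by apply: continuous_subspaceT; exact: on_segment_continuous.
Qed.

Lemma on_segment0 u v : on_segment u v 0 = u.
Proof. by rewrite /on_segment !mul0r !addr0; case: u. Qed.

Lemma on_segment1 u v : on_segment u v 1 = v.
Proof. by rewrite /on_segment !mul1r !subrKC; case: v. Qed.

Lemma exit_segment V u w : open V -> V u -> ~ V w ->
  exists2 l, 0 < l <= 1 & closure V (on_segment u w l) /\ ~ V (on_segment u w l).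
Proof.
move=> oV Vu nVw; apply: contrapT => /forall2NP nex.
set X := on_segment u w @` `[0, 1].
have cX : connected X := @segment_set_connected u w.
suff : X `&` V = X.
  move=> e; have : X w by exists 1; [rewrite /= in_itv /= ler01 lexx|exact: on_segment1].
  by rewrite -e => -[].
apply: cX.
- exists u; split => //; exists 0; [by rewrite /= in_itv /= ler01 lexx|exact: on_segment0].
- by exists V.
- exists (closure V); first exact: closed_closure.
  apply/seteqP; split => z [Xz Vz]; split => //; first exact: subset_closure.
  case: Xz Vz => l; rewrite /= in_itv /= => /andP[l0 l1] <- cVl.
  move: l0; rewrite le_eqVlt => /predU1P[<-|l0]; first by rewrite on_segment0.
  by case: (nex l) => [|/not_andP[//|/contrapT//]]; rewrite l0 l1.
Qed.

Lemma convex_lt (a b c l : R) : a < c -> b < c -> 0 <= l <= 1 -> a + l * (b - a) < c.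
Proof.
move=> ac bc /andP[l0 l1]; rewrite -subr_gt0.
have -> : c - (a + l * (b - a)) = (1 - l) * (c - a) + l * (c - b) by ring.
move: l0; rewrite le_eqVlt => /predU1P[<-|l0]; first by lra.
by apply: ltr_wpDl; [apply: mulr_ge0|apply: mulr_gt0]; lra.
Qed.

Lemma convex_le (a b c l : R) : a <= c -> b <= c -> 0 <= l <= 1 -> a + l * (b - a) <= c.
Proof.
move=> ac bc /andP[l0 l1]; rewrite -subr_ge0.
have -> : c - (a + l * (b - a)) = (1 - l) * (c - a) + l * (c - b) by ring.
by apply: addr_ge0; apply: mulr_ge0; lra.
Qed.

Lemma convex_gt (a b c l : R) : c < a -> c < b -> 0 <= l <= 1 -> c < a + l * (b - a).
Proof.
move=> ca cb hl; have := @convex_lt (- a) (- b) (- c) l; rewrite !ltrN2 => /(_ ca cb hl).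
by rewrite -ltrN2; congr (_ < _); ring.
Qed.

Lemma convex_ge (a b c l : R) : c <= a -> c <= b -> 0 <= l <= 1 -> c <= a + l * (b - a).
Proof.
move=> ca cb hl; have := @convex_le (- a) (- b) (- c) l; rewrite !lerN2 => /(_ ca cb hl).
by rewrite -lerN2; congr (_ <= _); ring.
Qed.

Lemma on_segment_near p r u v l : near_pt p r u -> near_pt p r v -> 0 <= l <= 1 ->
  near_pt p r (on_segment u v l).
Proof.
rewrite /near_pt /on_segment !ltr_norml !ltrBlDr !ltrBrDr /=.
move=> [/andP[u1 u2] /andP[u3 u4]] [/andP[v1 v2] /andP[v3 v4]] hl.
by rewrite !convex_lt ?convex_gt.
Qed.

Lemma on_segment_strip (W : R) u v l : strip W u -> strip W v -> 0 <= l <= 1 ->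
  strip W (on_segment u v l).
Proof.
rewrite /strip /on_segment /= => -[/andP[u1 u2] u3] [/andP[v1 v2] v3] hl.
by rewrite convex_le ?convex_ge.
Qed.

Definition open_strip (W : R) : set (pt R) := [set p | 0 < p.1 < W /\ 0 < p.2].

Lemma on_segment_open_strip (W : R) u v l : open_strip W u -> open_strip W v -> 0 <= l <= 1 ->
  open_strip W (on_segment u v l).
Proof.
rewrite /open_strip /on_segment /= => -[/andP[u1 u2] u3] [/andP[v1 v2] v3] hl.
by rewrite convex_lt ?convex_gt.
Qed.

Lemma near_pt_refl p r : 0 < r -> near_pt p r p.
Proof. by rewrite /near_pt !subrr normr0. Qed.

Lemma near_pt_le p r r' q : r <= r' -> near_pt p r q -> near_pt p r' q.
Proof. by move=> rr [h1 h2]; split; exact: lt_le_trans rr. Qed.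

Lemma near_pt_nested p r q : near_pt p r q -> exists2 r', 0 < r' &
  forall z, near_pt q r' z -> near_pt p r z.
Proof.
move=> [h1 h2]; exists (Num.min (r - `|q.1 - p.1|) (r - `|q.2 - p.2|)).
  by rewrite lt_min !subr_gt0 h1.
move=> z []; rewrite !lt_min => /andP[z1 _] /andP[_ z2]; split.
  have -> : z.1 - p.1 = (z.1 - q.1) + (q.1 - p.1) by ring.
  by apply: le_lt_trans (ler_normD _ _) _; rewrite -ltrBrDr.
have -> : z.2 - p.2 = (z.2 - q.2) + (q.2 - p.2) by ring.
by apply: le_lt_trans (ler_normD _ _) _; rewrite -ltrBrDr.
Qed.

Lemma component_near (W : R) (A : set (pt R)) p r q : 0 < r ->
  (forall z, strip W z -> near_pt p r z -> A z) ->
  strip W p -> strip W q -> near_pt p r q -> connected_component A p q.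
Proof.
move=> r0 hA sp sq nq.
have Xq : (on_segment p q @` `[0, 1]) q.
  by exists 1; [rewrite /= in_itv /= ler01 lexx|exact: on_segment1].
apply: (connected_component_max _ _ (@segment_set_connected p q)) Xq.
  by exists 0; [rewrite /= in_itv /= ler01 lexx|exact: on_segment0].
move=> _ [l hl <-]; move: hl; rewrite /= in_itv /= => hl; apply: hA.
  exact: on_segment_strip.
by apply: on_segment_near => //; exact: near_pt_refl.
Qed.

Lemma csq_far (s : nat -> R) (pos : nat -> pt R) j p : ~ csq s pos j p ->
  exists2 r, 0 < r & forall q, near_pt p r q -> ~ csq s pos j q.
Proof.
move=> np; have cl : closed (csq s pos j).
  rewrite (_ : csq s pos j = ([set p | (pos j).1 <= p.1] `&` [set p | p.1 <= (pos j).1 + s j])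
     `&` ([set p | (pos j).2 <= p.2] `&` [set p | p.2 <= (pos j).2 + s j])).
    apply: closedI; apply: closedI.
    - exact: closed_fst_ge.
    - exact: closed_fst_le.
    - exact: closed_snd_ge.
    - exact: closed_snd_le.
  apply/seteqP; split => q; rewrite /csq /=; first by move=> [/andP[-> ->] /andP[-> ->]].
  by move=> [[-> ->] [-> ->]].
have /pt_nbhsP[r r0 rP] : nbhs p (~` csq s pos j).
  by apply: open_nbhs_nbhs; split => //; exact: closed_openC.
by exists r => // q [q1 q2]; exact: rP.
Qed.

Lemma csq_cover (W : R) (s : nat -> R) (pos : nat -> pt R) k j : (j < k)%N ->
  csq s pos j `<=` Defs.cover W s pos k.
Proof.
elim: k => // k IH; rewrite ltnS leq_eqVlt => /predU1P[->|/IH h] p hp; left.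
  by right.
by left; exact: h.
Qed.

(** Inductively, if [p] is not yet covered, a whole neighbourhood of it in the strip lies in one
    component of the free space, and this component is absorbed or kept as a whole. *)
Lemma cover_local (W : R) (s : nat -> R) (pos : nat -> pt R) k p : strip W p ->
  (forall j, (j < k)%N -> ~ csq s pos j p) ->
  exists2 r, 0 < r & (forall q, strip W q -> near_pt p r q -> Defs.cover W s pos k q) \/
                     (forall q, strip W q -> near_pt p r q -> ~ Defs.cover W s pos k q).
Proof.
move=> sp; elim: k => [_|k IH hp]; first by exists 1 => //; right => q _ _ [].
have [|r r0 [h|h]] := IH; first by move=> j jk; exact: hp j (ltnW jk).
  by exists r => //; left => q sq nq; left; left; exact: h.
have [r1 r10 h1] := csq_far (hp k (leqnn _)).
pose A := strip W `\` (Defs.cover W s pos k `|` csq s pos k).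
pose m := Num.min r r1.
have m0 : 0 < m by rewrite lt_min r0.
have mA q : strip W q -> near_pt p m q -> A q.
  move=> sq nq; split => // -[cq|cq].
    by apply: (h q sq _ cq); apply: near_pt_le nq; rewrite ge_min lexx.
  by apply: (h1 q _ cq); apply: near_pt_le nq; rewrite ge_min lexx orbT.
have Ap : A p by apply: mA => //; exact: near_pt_refl.
exists m => //.
have [bd|nbd] := pselect (bounded_pl (connected_component A p)).
  left => q sq nq; right; exists (connected_component A p).
    by split => //; exists p.
  exact: (component_near m0 mA sp sq nq).
right => q sq nq [cq|[_ [[x Ax ->] bx] cq]]; first by case: (mA q sq nq) => _ /(_ cq).
apply: nbd; suff -> : connected_component A p = connected_component A x by [].
apply: same_connected_component.
apply: connected_component_trans (connected_component_sym cq).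
exact: (component_near m0 mA sp sq nq).
Qed.

Lemma piece_local (W : R) (s : nat -> R) (pos : nat -> pt R) k U : pieces W s pos k U ->
  forall p, U p -> exists2 r, 0 < r & forall q, strip W q -> near_pt p r q -> U q.
Proof.
move=> [[x [sx nx] ->] _] p Up.
set A := _ `\` _ in Up *.
have [sp np] := connected_component_sub Up.
have [|r r0 h] := @cover_local W s pos k p sp.
  by move=> j jk cj; apply: np; left; exact: (@csq_cover W s pos k j jk p cj).
case: h => h; first by case: np; left; apply: h => //; exact: near_pt_refl.
have [|r1 r10 h1] := @csq_far s pos k p; first by move=> cj; apply: np; right.
pose m := Num.min r r1.
have m0 : 0 < m by rewrite lt_min r0.
exists m => // q sq nq; apply: connected_component_trans Up _.
apply: (component_near m0 _ sp sq nq) => z sz nz; split => // -[cz|cz].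
  by apply: (h z sz _ cz); apply: near_pt_le nz; rewrite ge_min lexx.
by apply: (h1 z _ cz); apply: near_pt_le nz; rewrite ge_min lexx orbT.
Qed.

Lemma connected_locally_constant U (Q : pt R -> Prop) : connected U ->
  (forall p, U p -> exists2 r, 0 < r & forall q, U q -> near_pt p r q -> (Q q <-> Q p)) ->
  forall p q, U p -> U q -> Q p -> Q q.
Proof.
move=> cU loc p q Up Uq Qp; suff e : U `&` Q = U by move: Uq; rewrite -e => -[].
apply: cU; first by exists p.
- exists (interior [set z | U z -> Q z]); first exact: open_interior.
  apply/seteqP; split => z [Uz]; last by move=> /interior_subset/(_ Uz).
  move=> Qz; split => //; apply/pt_nbhsP.
  have [r r0 h] := loc z Uz; exists r => // y y1 y2 Uy.
  by apply/(h y Uy).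
- exists (~` interior [set z | U z -> ~ Q z]); first exact/open_closedC/open_interior.
  apply/seteqP; split => z [Uz]; first by move=> Qz; split => // /interior_subset/(_ Uz).
  move=> nz; split => //; apply: contrapT => nQz; apply: nz; apply/pt_nbhsP.
  have [r r0 h] := loc z Uz; exists r => // y y1 y2 Uy Qy.
  by apply: nQz; apply/(h y Uy).
Qed.

(** * The open part of a piece *)

Section OpenPart.
Variables (W : R) (U : set (pt R)).
Hypothesis (hW : 0 < W) (Ustrip : U `<=` strip W) (Uconn : connected U).
Hypothesis Uloc : forall p, U p ->
  exists2 r, 0 < r & forall q, strip W q -> near_pt p r q -> U q.

Let V := U `&` open_strip W.

Lemma open_strip_near p (r : R) : strip W p -> 0 < r ->
  exists2 q, open_strip W q & near_pt p r q.
Proof.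
move=> [/andP[p1 p2] p3] r0.
(* The point moves a fraction [d] of the way to the middle of the strip and up by [d]. Both
   displacements are at most [d * (W + 1)], which is below [r]. *)
pose d := Num.min (1 / 2) (r / (W + 1) / 2).
have W1 : 0 < W + 1 by lra.
have rW : 0 < r / (W + 1) by rewrite divr_gt0.
have d0 : 0 < d by rewrite lt_min; lra.
have d1 : d <= 1 / 2 by rewrite ge_min lexx.
have d2 : d * (W + 1) < r.
  have xr : r / (W + 1) * (W + 1) = r by rewrite divfK // gt_eqF.
  have : d * (W + 1) <= r / (W + 1) / 2 * (W + 1).
    by apply: ler_wpM2r; [lra|rewrite ge_min lexx orbT].
  by rewrite mulrAC xr; lra.
have e1 : 0 < d * W by exact: mulr_gt0.
have e2 : 0 <= d * p.1 by apply: mulr_ge0; lra.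
have e3 : d * p.1 <= d * W by rewrite ler_pM2l.
have e4 : d * (W - p.1) <= 1 / 2 * (W - p.1) by apply: ler_wpM2r; lra.
have e5 : d * p.1 <= 1 / 2 * p.1 by apply: ler_wpM2r; lra.
rewrite mulrBr in e4; rewrite mulrDr mulr1 in d2.
exists (p.1 + d * (W / 2 - p.1), p.2 + d).
  by rewrite /open_strip /= mulrBr mulrA; split; lra.
rewrite /near_pt /= !ltr_norml mulrBr mulrA; split; lra.
Qed.

Lemma strip_open_strip : open_strip W `<=` strip W.
Proof. by move=> p [p1 p2]; split; lra. Qed.

Lemma open_part_open : open V.
Proof.
rewrite openE => p [Up [p1 p2]]; apply/pt_nbhsP.
have [r r0 h] := Uloc Up.
pose m := Num.min (Num.min r p.2) (Num.min p.1 (W - p.1)).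
have m0 : 0 < m by rewrite !lt_min r0 p2; lra.
have m1 : m <= r by rewrite !ge_min lexx.
have m2 : m <= p.2 by rewrite !ge_min lexx orbT.
have m3 : m <= p.1 by rewrite !ge_min lexx !orbT.
have m4 : m <= W - p.1 by rewrite !ge_min lexx !orbT.
exists m => // q q1 q2.
have oq : open_strip W q by move: q1 q2; rewrite !ltr_norml => q1 q2; split; lra.
split => //; apply: h; first exact: strip_open_strip.
by apply: (near_pt_le m1).
Qed.

Lemma open_part_near p : closure U p -> forall r, 0 < r -> exists2 q, V q & near_pt p r q.
Proof.
move=> /pt_closureP cp r r0; have [u [Uu u1 u2]] := cp r r0.
have [r1 r10 h1] : exists2 r' : R, 0 < r' & forall z, near_pt u r' z -> near_pt p r z.
  exact: near_pt_nested.
have [r2 r20 h2] := Uloc Uu.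
have [|q oq nq] := @open_strip_near u (Num.min r1 r2) (Ustrip Uu); first by rewrite lt_min r10.
exists q; last by apply: h1; apply: near_pt_le nq; rewrite ge_min lexx.
split => //; apply: h2; first exact: strip_open_strip.
by apply: near_pt_le nq; rewrite ge_min lexx orbT.
Qed.

Lemma open_part_closure : closure V = closure U.
Proof.
apply/seteqP; split; first by apply: closureS => p [].
move=> p cp; apply/pt_closureP => r r0.
by have [q Vq [q1 q2]] := open_part_near cp r0; exists q.
Qed.

Lemma open_part_interior : interior U = V.
Proof.
apply/seteqP; split; last first.
  move=> p Vp; apply: (@filterS _ (nbhs p) _ V) => [q []//|].
  by apply: open_nbhs_nbhs; split => //; exact: open_part_open.
move=> p /[dup] /interior_subset Up /pt_nbhsP[r r0 h]; split => //.
have [/andP[p1 p2] p3] := Ustrip Up.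
have r2 : `|r / 2| < r by rewrite gtr0_norm; lra.
have n0 (x : R) : x + r / 2 - x = r / 2 by ring.
have n1 (x : R) : x - r / 2 - x = - (r / 2) by ring.
have hq q : `|q.1 - p.1| < r -> `|q.2 - p.2| < r -> strip W q.
  by move=> q1 q2; apply: Ustrip; exact: h.
have [/andP[_ a2] _] : strip W (p.1 + r / 2, p.2).
  by apply: hq; rewrite /= ?n0 ?subrr ?normr0.
have [/andP[b1 _] b3] : strip W (p.1 - r / 2, p.2 - r / 2).
  by apply: hq; rewrite /= n1 normrN.
by move: a2 b1 b3 => /= *; split; lra.
Qed.

Lemma open_part_connected : connected V.
Proof.
move=> B B0 [O oO BO] [D cD BD].
have seg u v : (forall l, 0 <= l <= 1 -> V (on_segment u v l)) -> B u -> B v.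
  move=> sV Bu; set X := on_segment u v @` `[0, 1].
  have XV : X `<=` V by move=> _ [l hl <-]; apply: sV; move: hl; rewrite /= in_itv.
  have Xu : X u by exists 0; [rewrite /= in_itv /= ler01 lexx|exact: on_segment0].
  have Xv : X v by exists 1; [rewrite /= in_itv /= ler01 lexx|exact: on_segment1].
  suff e : X `&` B = X by move: Xv; rewrite -e => -[].
  apply: (@segment_set_connected u v); first by exists u.
    by exists O => //; rewrite BO setIA (setIidl XV).
  by exists D => //; rewrite BD setIA (setIidl XV).
have BV : B `<=` V by rewrite BO => z [].
(* [Q] extends membership in [B] to the points of [U] on the walls and the floor. It is locally
   constant because [V] is convex near each point of [U], so connectedness of [U] carries over. *)
pose Q p := exists2 r, 0 < r & forall q, V q -> near_pt p r q -> B q.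
have ball p r : 0 < r -> (forall q, strip W q -> near_pt p r q -> U q) ->
    forall q q0, U q -> near_pt p r q -> V q0 -> near_pt p r q0 -> (Q q <-> B q0).
  move=> r0 h q q0 Uq nq Vq0 nq0.
  have conv u v : V u -> V v -> near_pt p r u -> near_pt p r v ->
      forall l, 0 <= l <= 1 -> V (on_segment u v l).
    move=> [_ ou] [_ ov] nu nv l hl.
    have ol := on_segment_open_strip ou ov hl.
    by split => //; apply: h; [exact: strip_open_strip|exact: on_segment_near].
  have [r1 r10 h1] := near_pt_nested nq.
  split=> [[r2 r20 h2]|Bq0].
    have [|q1 Vq1 nq1] := @open_part_near q (subset_closure Uq) (Num.min r1 r2).
      by rewrite lt_min r10.
    apply: (seg q1).
      by apply: conv => //; apply: h1; apply: near_pt_le nq1; rewrite ge_min lexx.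
    by apply: h2 => //; apply: near_pt_le nq1; rewrite ge_min lexx orbT.
  by exists r1 => // z Vz nz; apply: (seg q0) => //; apply: conv => //; exact: h1.
have loc p : U p -> exists2 r, 0 < r & forall q, U q -> near_pt p r q -> (Q q <-> Q p).
  move=> Up; have [r r0 h] := Uloc Up; exists r => // q Uq nq.
  have [q0 Vq0 nq0] := open_part_near (subset_closure Up) r0.
  have e1 := ball p r r0 h q q0 Uq nq Vq0 nq0.
  have e2 := ball p r r0 h p q0 Up (near_pt_refl p r0) Vq0 nq0.
  exact: iff_trans e1 (iff_sym e2).
apply/seteqP; split => // v Vv; case: B0 => b Bb.
have QB u : V u -> Q u <-> B u.
  move=> Vu; have [r r0 h] := Uloc Vu.1.
  by apply: (ball u r r0 h) => //; [case: Vu|exact: near_pt_refl|exact: near_pt_refl].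
apply/(QB v Vv); apply: (connected_locally_constant Uconn loc (p := b)).
- by case: (BV b Bb).
- by case: Vv.
- by apply/(QB b (BV b Bb)).
Qed.

End OpenPart.

End Pieces.

(** * Bottom-left packings *)

Section Supports.
Variables (R : realType) (W : R) (n : nat) (s : nat -> R) (pos : nat -> pt R).
Hypothesis (hW : 0 < W) (hs : forall j, (j < n)%N -> 0 < s j <= W).
Hypothesis hBL : bottom_left W n s pos.

Definition separated (a : pt R) (c : R) (b : pt R) (d : R) : Prop :=
  [\/ a.1 + c <= b.1, b.1 + d <= a.1, a.2 + c <= b.2 | b.2 + d <= a.2].

Lemma osq_separated (a b : pt R) (c d : R) :
  separated a c b d -> osq a c `&` osq b d = set0.
Proof.
move=> sep; apply/seteqP; split => // q [[ax ay] [bx by_]].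
by case: sep => h; exfalso; lra.
Qed.

Lemma separated_osq (a b : pt R) (c d : R) : 0 < c -> 0 < d ->
  osq a c `&` osq b d = set0 -> separated a c b d.
Proof.
move=> c0 d0 dis.
have [h1|h1] := le_or_lt (a.1 + c) b.1; first exact: Or41.
have [h2|h2] := le_or_lt (b.1 + d) a.1; first exact: Or42.
have [h3|h3] := le_or_lt (a.2 + c) b.2; first exact: Or43.
have [h4|h4] := le_or_lt (b.2 + d) a.2; first exact: Or44.
have between (x y z w : R) : x < z -> x < w -> y < z -> y < w -> exists m, x < m < z /\ y < m < w.
  move=> xz xw yz yw.
  have xM : x <= Num.max x y by rewrite le_max lexx.
  have yM : y <= Num.max x y by rewrite le_max lexx orbT.
  have mz : Num.min z w <= z by rewrite ge_min lexx.
  have mw : Num.min z w <= w by rewrite ge_min lexx orbT.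
  have Mm : Num.max x y < Num.min z w by rewrite gt_max !lt_min xz xw yz yw.
  by exists ((Num.max x y + Num.min z w) / 2); split; lra.
have [||||x [x1 x2]] := between a.1 b.1 (a.1 + c) (b.1 + d); [lra|lra|lra|lra|].
have [||||y [y1 y2]] := between a.2 b.2 (a.2 + c) (b.2 + d); [lra|lra|lra|lra|].
by have : (osq a c `&` osq b d) (x, y) by []; rewrite dis.
Qed.

Lemma squares_separated i j : (i < n)%N -> (j < n)%N -> i <> j ->
  separated (pos i) (s i) (pos j) (s j).
Proof.
move=> iN jN ij.
have [si _] := andP (hs iN); have [sj _] := andP (hs jN).
apply: separated_osq => //.
have [ltij|ltji|//] := ltngtP i j.
  by rewrite setIC; have [[_ [_ [_ h]]] _] := hBL jN; exact: h.
by have [[_ [_ [_ h]]] _] := hBL iN; exact: h.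
Qed.

Lemma finite_gap (Q : nat -> Prop) (g : nat -> R) m :
  (forall i, (i < m)%N -> Q i -> 0 < g i) ->
  exists2 e, 0 < e & forall i, (i < m)%N -> Q i -> e <= g i.
Proof.
elim: m => [|m IH] h; first by exists 1.
have [|e e0 he] := IH; first by move=> i im; exact: h i (ltnW im).
have [Qm|nQm] := pselect (Q m); last first.
  exists e => // i; rewrite ltnS leq_eqVlt => /predU1P[->//|]; exact: he.
exists (Num.min e (g m)); first by rewrite lt_min e0 h.
move=> i; rewrite ltnS leq_eqVlt => /predU1P[->_|im Qi]; rewrite ge_min ?lexx ?orbT //.
by rewrite he.
Qed.

Lemma bottom_support j : (j < n)%N -> 0 < (pos j).2 ->
  exists i, [/\ (i < j)%N, (pos i).2 + s i = (pos j).2,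
    (pos i).1 < (pos j).1 + s j & (pos j).1 < (pos i).1 + s i].
Proof.
move=> jN y0; apply: contrapT => nsup.
have [[f1 [f2 [f3 f4]]] minj] := hBL jN.
have [sj _] := andP (hs jN).
pose Q i := ((pos i).1 < (pos j).1 + s j /\ (pos j).1 < (pos i).1 + s i) /\
  (pos i).2 + s i <= (pos j).2.
have [|e e0 he] := @finite_gap Q (fun i => (pos j).2 - ((pos i).2 + s i)) j.
  move=> i ij [[h1 h2] h3]; rewrite subr_gt0 lt_neqAle h3 andbT; apply/eqP => h4.
  by apply: nsup; exists i.
pose m := Num.min e (pos j).2.
have m0 : 0 < m by rewrite lt_min e0.
have me : m <= e by rewrite ge_min lexx.
have my : m <= (pos j).2 by rewrite ge_min lexx orbT.
case: (minj ((pos j).1, (pos j).2 - m)) => [|/=|/=[]]; [|lra|lra].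
split=> //=; split=> //; split; first by lra.
move=> i ij; apply: osq_separated.
have [si _] := andP (hs (ltn_trans ij jN)).
have [h|h|h|h] := squares_separated jN (ltn_trans ij jN) (fun e => ltac:(by rewrite e ltnn in ij)).
- exact: Or41.
- exact: Or42.
- by apply: Or43; move=> /=; lra.
have [h1|h1] := le_or_lt ((pos j).1 + s j) (pos i).1; first exact: Or41.
have [h2|h2] := le_or_lt ((pos i).1 + s i) (pos j).1; first exact: Or42.
by have := he i ij (conj (conj h1 h2) h); move=> h3; apply: Or44 => /=; lra.
Qed.

(** A shift to the left keeps the height, so the second component of the lexicographic order is
    contradicted. *)
Lemma left_support j : (j < n)%N -> 0 < (pos j).1 ->
  exists i, [/\ (i < j)%N, (pos i).1 + s i = (pos j).1,
    (pos i).2 < (pos j).2 + s j & (pos j).2 < (pos i).2 + s i].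
Proof.
move=> jN x0; apply: contrapT => nsup.
have [[f1 [f2 [f3 f4]]] minj] := hBL jN.
have [sj _] := andP (hs jN).
pose Q i := ((pos i).2 < (pos j).2 + s j /\ (pos j).2 < (pos i).2 + s i) /\
  (pos i).1 + s i <= (pos j).1.
have [|e e0 he] := @finite_gap Q (fun i => (pos j).1 - ((pos i).1 + s i)) j.
  move=> i ij [[h1 h2] h3]; rewrite subr_gt0 lt_neqAle h3 andbT; apply/eqP => h4.
  by apply: nsup; exists i.
pose m := Num.min e (pos j).1.
have m0 : 0 < m by rewrite lt_min e0.
have me : m <= e by rewrite ge_min lexx.
have mx : m <= (pos j).1 by rewrite ge_min lexx orbT.
case: (minj ((pos j).1 - m, (pos j).2)) => [|/=|/=[]]; [|lra|lra].
split=> /=; first by lra.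
split; [lra|split => // i ij]; apply: osq_separated.
have [si _] := andP (hs (ltn_trans ij jN)).
have [h|h|h|h] := squares_separated jN (ltn_trans ij jN) (fun e => ltac:(by rewrite e ltnn in ij)).
- by apply: Or41 => /=; lra.
- have [h1|h1] := le_or_lt ((pos j).2 + s j) (pos i).2; first exact: Or43.
  have [h2|h2] := le_or_lt ((pos i).2 + s i) (pos j).2; first exact: Or44.
  by have := he i ij (conj (conj h1 h2) h); move=> h3; apply: Or42 => /=; lra.
- exact: Or43.
- exact: Or44.
Qed.

(* The walls and the floor are thickened outwards, so that all (formal) squares
   become nondegenerate rectangles with disjoint interiors; the walls are cut at
   a height [H] exceeding the piece under consideration. *)
Definition thick (H : R) (S : fsq) : rect R :=
  match S with
  | FSq j => Rect (pos j).1 ((pos j).1 + s j) (pos j).2 ((pos j).2 + s j)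
  | FLeft => Rect (-1) 0 0 H
  | FRight => Rect W (W + 1) 0 H
  | FBottom => Rect 0 W (-1) 0
  end.

Variables (k : nat) (H : R).
Hypothesis (hk : (k < n)%N) (hH : 0 < H).

Lemma thick_nondeg S : fsq_valid k S ->
  xmin (thick H S) < xmax (thick H S) /\ ymin (thick H S) < ymax (thick H S).
Proof.
case: S => [j|||] /= v; last 3 first.
- by split; [lra|exact: hH].
- by split; [lra|exact: hH].
- by split; [exact: hW|lra].
by have [sj _] := andP (hs (leq_ltn_trans v hk)); split; lra.
Qed.

Lemma square_in_strip j : (j <= k)%N ->
  [/\ 0 <= (pos j).1, (pos j).1 + s j <= W & 0 <= (pos j).2].
Proof. by move=> jk; have [[h1 [h2 [h3 _]]] _] := hBL (leq_ltn_trans jk hk). Qed.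

Lemma thick_disj S1 S2 : fsq_valid k S1 -> fsq_valid k S2 -> S1 <> S2 ->
  [\/ xmax (thick H S1) <= xmin (thick H S2), xmax (thick H S2) <= xmin (thick H S1),
      ymax (thick H S1) <= ymin (thick H S2) | ymax (thick H S2) <= ymin (thick H S1)].
Proof.
case: S1 => [i|||]; case: S2 => [j|||] //= v1 v2 ne.
- have ij : i <> j by move=> e; apply: ne; rewrite e.
  exact: (squares_separated (leq_ltn_trans v1 hk) (leq_ltn_trans v2 hk) ij).
- by have [? ? ?] := square_in_strip v1; apply: Or42.
- by have [? ? ?] := square_in_strip v1; apply: Or41.
- by have [? ? ?] := square_in_strip v1; apply: Or44.
- by have [? ? ?] := square_in_strip v2; apply: Or41.
- by apply: Or41; exact: ltW.
- by apply: Or41.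
- by have [? ? ?] := square_in_strip v2; apply: Or42.
- by apply: Or42; exact: ltW.
- by apply: Or42.
- by have [? ? ?] := square_in_strip v2; apply: Or43.
- by apply: Or42.
- by apply: Or41.
Qed.

Lemma thick_half S : fsq_valid k S -> 0 <= ymin (thick H S) \/ ymax (thick H S) <= 0.
Proof.
case: S => [j|||] //= v; try by left.
  by have [? ? ?] := square_in_strip v; left.
by right.
Qed.

Lemma bottom_chain S : fsq_valid k S -> exists l, chain (thick H) (fsq_valid k) S l.
Proof.
case: S => [j|||] v; try by eexists; apply: chain_ground => //=; lra.
elim/ltn_ind: j v => j IH v.
have [y0|y0] := le_or_lt (pos j).2 0; first by eexists; apply: chain_ground.
have [i [ij e1 e2 e3]] := bottom_support (leq_ltn_trans v hk) y0.
have [l ch] := IH i ij (leq_trans (ltnW ij) v).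
by exists (FSq j :: l); apply: chain_support ch.
Qed.

Lemma left_chain S : fsq_valid k S -> S <> FRight ->
  exists l, chain (@swap_rect R \o thick H) (fsq_valid k) S l.
Proof.
case: S => [j|||] v ne //; try by eexists; apply: chain_ground => //=; lra.
elim/ltn_ind: j v {ne} => j IH v.
have [x0|x0] := le_or_lt (pos j).1 0; first by eexists; apply: chain_ground.
have [i [ij e1 e2 e3]] := left_support (leq_ltn_trans v hk) x0.
have [l ch] := IH i ij (leq_trans (ltnW ij) v).
by exists (FSq j :: l); apply: chain_support ch.
Qed.

End Supports.

(** * Arrows of the circuit *)

Section Structure.
Variables (R : realType) (I : eqType).
Variables (f : I -> rect R) (P : I -> Prop) (U V B : set (pt R)).
Variables (gamma : R -> pt R) (C : seq I) (x0 : I) (b : nat -> R).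
Hypothesis ct : circuit f P U V B gamma C x0 b.
Hypothesis (oV : open V) (V0 : V !=set0).
Variable M : R.
Hypothesis VM : forall u, V u -> u.2 < M.

Let pk := circuit_packing ct.

Lemma boundary_closure p : B p -> closure V p.
Proof. by move=> /(circuit_boundary ct)[]. Qed.

Lemma exit_vertical u : V u ->
  (exists2 z, B z & z.1 = u.1 /\ u.2 < z.2) /\ (exists2 z, B z & z.1 = u.1 /\ z.2 < u.2).
Proof.
move=> Vu; have uM := VM Vu; have [_ u0] := packing_pos pk Vu; split.
  have nV : ~ V (u.1, M) by move/VM; rewrite /= ltxx.
  have [l hl [cz nz]] := exit_segment oV Vu nV.
  exists (on_segment u (u.1, M) l); first by apply/(circuit_boundary ct).
  rewrite /on_segment /= subrr mulr0 addr0; split=> //.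
  by have : 0 < l * (M - u.2) by [apply: mulr_gt0; lra]; lra.
have nV : ~ V (u.1, 0) by move/(packing_pos pk) => /= [_]; rewrite ltxx.
have [l hl [cz nz]] := exit_segment oV Vu nV.
exists (on_segment u (u.1, 0) l); first by apply/(circuit_boundary ct).
rewrite /on_segment /= subrr mulr0 addr0; split=> //.
by have : 0 < l * u.2 by [apply: mulr_gt0; lra]; rewrite sub0r mulrN; lra.
Qed.

Lemma square_above u : V u -> exists2 A, A \in C & xmin (f A) <= u.1 <= xmax (f A) /\ u.2 < ymin (f A).
Proof.
move=> Vu; have [[z Bz [z1 z2]] _] := exit_vertical Vu.
have [A AC [Ax Ay]] := circuit_point ct Bz; exists A => //; rewrite -z1; split=> //.
have [//|h] := lt_or_le u.2 (ymin (f A)).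
by case: (packing_free pk (circuit_valid ct AC) Vu); split; lra.
Qed.

Lemma square_below u : V u -> exists2 A, A \in C & xmin (f A) <= u.1 <= xmax (f A) /\ ymax (f A) < u.2.
Proof.
move=> Vu; have [_ [z Bz [z1 z2]]] := exit_vertical Vu.
have [A AC [Ax Ay]] := circuit_point ct Bz; exists A => //; rewrite -z1; split=> //.
have [//|h] := lt_or_le (ymax (f A)) u.2.
by case: (packing_free pk (circuit_valid ct AC) Vu); split; lra.
Qed.

(** A square containing the whole boundary would contain boundary points straight above and straight
    below a point of [V], hence that point. *)
Lemma arc_proper j : (j < size C)%N -> b j.+1 < b j + 1.
Proof.
move=> jm; have [//|h] := lt_or_le (b j.+1) (b j + 1).
have [gc gp gi gB gR] := circuit_curve ct.
have all z : B z -> in_rect (f (nth x0 C j)) z.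
  move=> /gB[t <-]; have [t' ht' <-] := gamma_time gp (b j) t.
  by apply: (circuit_arc ct) => //; lra.
have [u Vu] := V0; have [[z Bz [z1 z2]] [z' Bz' [z1' z2']]] := exit_vertical Vu.
have [zx zy] := all z Bz; have [_ zy'] := all z' Bz'.
case: (packing_free pk (circuit_valid ct (mem_nth x0 jm)) Vu); split; lra.
Qed.

(** Start from a point of [V] near [p] off both axes. A segment inside its quadrant could leave [V]
    only into a rectangle of [C], which would contain the whole quadrant near [p] and so the
    starting point. *)
Lemma boundary_quadrant p : B p -> exists qa qb, quadrant_in V qa qb p.
Proof.
move=> Bp; have [r [r0 _ clear]] := clear_radius_ex f C p (@ltr01 R).
have [v0 Vv0 v0p] : exists2 v, V v & near_pt p r v.
  by have /pt_closureP/(_ r r0)[v [? ? ?]] := boundary_closure Bp; exists v.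
have [r1 r10 h1] := near_pt_nested v0p.
have /pt_nbhsP[r2 r20 h2] : nbhs v0 V by exact: open_nbhs_nbhs.
have shiftx (x y d : R) : 0 < d -> exists x', `|x' - x| < d /\ x' <> y.
  move=> d0; have [xy|/eqP xy] := eqVneq x y; last by exists x; rewrite subrr normr0.
  by exists (x + d / 2); rewrite ltr_norml xy; split; lra.
have m0 : 0 < Num.min r1 r2 by rewrite lt_min r10.
have [x [x1 x2]] := shiftx v0.1 p.1 _ m0; have [y [y1 y2]] := shiftx v0.2 p.2 _ m0.
pose v : pt R := (x, y).
have nv : near_pt v0 (Num.min r1 r2) v by split.
have Vv : V v.
  by apply: h2; [case: nv => + _|case: nv => _ +]; rewrite lt_min => /andP[].
have vp : near_pt p r v by apply: h1; apply: near_pt_le nv; rewrite ge_min lexx.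
pose qa := p.1 < v.1; pose qb := p.2 < v.2.
exists qa, qb, r => // s t hs ht.
have side (a : bool) (x' y' c : R) : 0 < c < r -> x' <> y' -> `|x' - y'| < r -> a = (y' < x') ->
   forall l, 0 <= l <= 1 ->
   exists2 d, 0 < d < r & x' + l * (y' + sg R a * c - x') = y' + sg R a * d.
  move=> hc ne; rewrite ltr_norml => nr -> l hl; rewrite /sg.
  case: ifP => yx.
    exists (x' + l * (y' + 1 * c - x') - y'); last by ring.
    by rewrite subr_gt0 ltrBlDr convex_gt ?convex_lt //; lra.
  have xy : x' < y'.
    by rewrite lt_neqAle; move/negbT: yx; rewrite -leNgt => ->; rewrite andbT; apply/eqP.
  exists (y' - (x' + l * (y' + -1 * c - x'))); last by ring.
  have lt1 : x' + l * (y' + -1 * c - x') < y' by apply: convex_lt => //; lra.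
  have lt2 : y' - r < x' + l * (y' + -1 * c - x') by apply: convex_gt => //; lra.
  by move: lt1 lt2; set X := x' + _ => *; lra.
apply: contrapT => nV; have [l hl [cz nz]] := exit_segment oV Vv nV.
have Bz : B (on_segment v (p.1 + sg R qa * s, p.2 + sg R qb * t) l) by apply/(circuit_boundary ct).
have [A AC [Ax Ay]] := circuit_point ct Bz.
move: Ax Ay; rewrite /on_segment /=; have hl' : 0 <= l <= 1 by lra.
have [d1 hd1 ->] := side qa x p.1 s hs x2 vp.1 erefl l hl'.
have [d2 hd2 ->] := side qb y p.2 t ht y2 vp.2 erefl l hl'.
have [[c1 c2] [c3 c4]] := clear A AC.
move=> /(in_side_of c1 c2 hd1) ix /(in_side_of c3 c4 hd2) iy.
have s0 : 0 <= (0 : R) <= 1 by lra.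
have [e1 he1 E1] := side qa x p.1 s hs x2 vp.1 erefl 0 s0.
have [e2 he2 E2] := side qb y p.2 t ht y2 vp.2 erefl 0 s0.
apply: (packing_free pk (circuit_valid ct AC) Vv); split => /=.
  by have /andP[/ltW + /ltW] := in_side_lt c1 c2 he1 ix; rewrite -E1 mul0r addr0 => -> ->.
by have /andP[/ltW + /ltW] := in_side_lt c3 c4 he2 iy; rewrite -E2 mul0r addr0 => -> ->.
Qed.

Definition reaches_l S (p : pt R) := xmin (f S) < p.1.
Definition reaches_r S (p : pt R) := p.1 < xmax (f S).
Definition reaches_d S (p : pt R) := ymin (f S) < p.2.
Definition reaches_u S (p : pt R) := p.2 < ymax (f S).
Definition covers S (qa qb : bool) (p : pt R) :=
  (if qa then reaches_r S p else reaches_l S p) &&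
  (if qb then reaches_u S p else reaches_d S p).

Lemma covers_quadrant S qa qb p : in_rect (f S) p -> covers S qa qb p -> in_quadrant (f S) qa qb p.
Proof.
rewrite /covers /reaches_l /reaches_r /reaches_u /reaches_d.
move=> [/andP[x1 x2] /andP[y1 y2]] /andP[]; rewrite /in_quadrant.
by case: qa => hx; case: qb => hy; split; rewrite ?hx ?hy ?x1 ?x2 ?y1 ?y2.
Qed.

(** [arrow_order] is all that is kept of the orientation: [S1] does not fill the counterclockwise
    neighbour of a quadrant of [V], and [S2] not the clockwise one. *)
Record arrow S1 S2 p : Prop := Arrow {
  arrow_mem1 : S1 \in C; arrow_mem2 : S2 \in C; arrow_neq : S1 <> S2;
  arrow_boundary : B p; arrow_in1 : in_rect (f S1) p; arrow_in2 : in_rect (f S2) p;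
  arrow_order : forall qa qb, quadrant_in V qa qb p ->
    [/\ ~~ covers S1 qa qb p, ~~ covers S2 qa qb p,
        ~~ covers S1 (~~ qb) qa p & ~~ covers S2 qb (~~ qa) p] }.

Lemma circuit_arrow i : (1 < size C)%N -> (i < size C)%N ->
  arrow (nth x0 C i) (nth x0 C (i.+1 %% size C)) (gamma (b i.+1)).
Proof.
move=> m1 im; set i' := (i.+1 %% size C)%N.
have m0 : (0 < size C)%N by exact: ltnW.
have im' : (i' < size C)%N by rewrite ltn_mod.
have [gc gp gi gB gR] := circuit_curve ct.
have gb : gamma (b i') = gamma (b i.+1).
  rewrite /i'; move: im; rewrite leq_eqVlt => /predU1P[->|im2].
    by rewrite modnn (circuit_closes ct) gp.
  by rewrite modn_small.
have in1 : in_rect (f (nth x0 C i)) (gamma (b i.+1)).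
  by apply: (circuit_arc ct) => //; rewrite lexx (circuit_mono ct im).
have in2 : in_rect (f (nth x0 C i')) (gamma (b i.+1)).
  by rewrite -gb; apply: (circuit_arc ct) => //; rewrite lexx (circuit_mono ct im').
have C1 := mem_nth x0 im; have C2 := mem_nth x0 im'.
split => //.
- move/eqP; rewrite nth_uniq ?(circuit_uniq ct)// => /eqP ii'.
  move: im; rewrite leq_eqVlt => /predU1P[e|lt]; first by move: ii'; rewrite /i' e modnn; move: m1; lia.
  by move: ii'; rewrite /i' modn_small //; lia.
- by apply/gB; exists (b i.+1).
- move=> qa qb q; split; apply/negP => c.
  + exact: (quadrant_free pk (circuit_valid ct C1) q (covers_quadrant in1 c)).
  + exact: (quadrant_free pk (circuit_valid ct C2) q (covers_quadrant in2 c)).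
  + exact: (arc_end_quadrant (sigma := true) ct im (arc_proper im) erefl q (covers_quadrant in1 c)).
  + exact: (arc_end_quadrant (sigma := false) ct im' (arc_proper im') gb q (covers_quadrant in2 c)).
Qed.

Definition left_at S1 S2 (p : pt R) := ~~ reaches_l S1 p && ~~ reaches_r S2 p.
Definition right_at S1 S2 (p : pt R) := ~~ reaches_r S1 p && ~~ reaches_l S2 p.
Definition up_at S1 S2 (p : pt R) := ~~ reaches_u S1 p && ~~ reaches_d S2 p.
Definition down_at S1 S2 (p : pt R) := ~~ reaches_d S1 p && ~~ reaches_u S2 p.

Lemma reaches_some S p : P S -> in_rect (f S) p ->
  (reaches_l S p || reaches_r S p) /\ (reaches_d S p || reaches_u S p).
Proof.
move=> PS [/andP[x1 x2] /andP[y1 y2]]; have [nx ny] := packing_nondeg pk PS.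
rewrite /reaches_l /reaches_r /reaches_u /reaches_d; split.
  by have [->//|h] := lt_or_le (xmin (f S)) p.1; rewrite (le_lt_trans h nx) orbT.
by have [->//|h] := lt_or_le (ymin (f S)) p.2; rewrite (le_lt_trans h ny) orbT.
Qed.

Lemma arrow_disjoint S1 S2 p qa qb : arrow S1 S2 p ->
  ~~ (covers S1 qa qb p && covers S2 qa qb p).
Proof.
move=> ar; apply/negP => /andP[c1 c2]; apply: (arrow_neq ar).
apply: (in_quadrant_inj pk _ _ (covers_quadrant (arrow_in1 ar) c1) (covers_quadrant (arrow_in2 ar) c2)).
  exact: (circuit_valid ct (arrow_mem1 ar)).
exact: (circuit_valid ct (arrow_mem2 ar)).
Qed.

(** Once the geometry is reduced to eight Booleans and a quadrant, this is an exhaustive check. The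
    second part isolates the two exceptional configurations: a vertical contact with [V] below, and
    a horizontal one with [V] to the left. *)
Lemma arrow_types S1 S2 p qa qb : arrow S1 S2 p -> quadrant_in V qa qb p ->
  (if qa == qb then (if qa then left_at S1 S2 p || up_at S1 S2 p
                     else right_at S1 S2 p || down_at S1 S2 p)
   else (if qa then right_at S1 S2 p || up_at S1 S2 p
         else left_at S1 S2 p || down_at S1 S2 p)) /\
  (~~ left_at S1 S2 p -> 
    (up_at S1 S2 p \/ [/\ qb = false, ~~ reaches_r S1 p, ~~ reaches_l S2 p & reaches_u S1 p]) \/
    [/\ qa = false, ~~ reaches_u S2 p, ~~ reaches_d S1 p, reaches_r S1 p & reaches_r S2 p]).
Proof.
move=> ar q; have [n1 n2 n3 n4] := arrow_order ar q.
have [a1 b1] := reaches_some (circuit_valid ct (arrow_mem1 ar)) (arrow_in1 ar).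
have [a2 b2] := reaches_some (circuit_valid ct (arrow_mem2 ar)) (arrow_in2 ar).
have dj x y := arrow_disjoint x y ar.
move: n1 n2 n3 n4 a1 b1 a2 b2 (dj true true) (dj true false) (dj false true) (dj false false).
rewrite /covers /left_at /right_at /up_at /down_at /= {q dj ar}.
move: (reaches_l S1 p) (reaches_r S1 p) (reaches_u S1 p) (reaches_d S1 p)
      (reaches_l S2 p) (reaches_r S2 p) (reaches_u S2 p) (reaches_d S2 p).
case: qa; case: qb => /=; do 8!case=> //=;
  move=> *; split=> // *; first [by left; left|by left; right|by right].
Qed.

Hypothesis half : forall S, P S -> 0 <= ymin (f S) \/ ymax (f S) <= 0.
Hypothesis bottom_chains : forall S, P S -> exists l, chain f P S l.
Variable wall : I.
Hypothesis left_chains : forall S, P S -> S <> wall ->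
  exists l, chain (@swap_rect R \o f) P S l.
Hypothesis wall_right : forall S, P S -> S <> wall -> xmax (f S) <= xmin (f wall).
Hypothesis wall_free : forall u, V u -> u.1 < xmin (f wall).

Lemma arrow_valid S1 S2 p : arrow S1 S2 p -> P S1 /\ P S2.
Proof. by case=> C1 C2 *; split; apply: (circuit_valid ct). Qed.

(** * Arrows near to and away from the top and end squares *)

Section Ends.
Variables (T E : I) (q : pt R).
Hypothesis TE : arrow T E q.
Hypothesis below_T : forall u, V u -> u.2 < ymin (f T).
Hypothesis tie : ymin (f E) = ymin (f T) -> xmax (f E) <= xmax (f T).

Lemma closure_below_T p : closure V p -> p.2 <= ymin (f T).
Proof.
by apply: closure_sub_closed (@closed_snd_le R _) _ p => u /below_T/ltW.
Qed.

Lemma touch_T p : closure V p -> in_rect (f T) p -> p.2 = ymin (f T).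
Proof. by move=> /closure_below_T h [_ /andP[h' _]]; apply/eqP; rewrite eq_le h h'. Qed.

Lemma quadrant_not_up p qa qb : p.2 = ymin (f T) -> quadrant_in V qa qb p -> qb = false.
Proof.
case: qb => // pT q'; have [s [t [hs ht /below_T /=]]] := quadrant_in_near q' (@ltr01 R).
by rewrite pT /sg; lra.
Qed.

Lemma end_corner : [/\ q.2 = ymin (f T), quadrant_in V false false q,
  xmin (f E) = q.1, ymin (f E) < q.2 <= ymax (f E) & in_quadrant (f E) true false q].
Proof.
have qT := touch_T (boundary_closure (arrow_boundary TE)) (arrow_in1 TE).
have [qa [qb qq]] := boundary_quadrant (arrow_boundary TE).
have eqb := quadrant_not_up qT qq; subst qb.
have [n1 n2 n3 n4] := arrow_order TE qq.
have [PT PE] := arrow_valid TE.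
have [a1 b1] := reaches_some PT (arrow_in1 TE); have [a2 b2] := reaches_some PE (arrow_in2 TE).
have dj x y := arrow_disjoint x y TE.
have D1 : reaches_d T q = false by rewrite /reaches_d qT ltxx.
(* The tie-breaking rule for the top square forbids an end square with the same bottom continuing to
   the right of it. *)
have tieE : ~~ [&& ~~ reaches_d E q, ~~ reaches_r T q & reaches_r E q].
  rewrite /reaches_d /reaches_r -!leNgt; apply/and3P => -[h1 h2 h3].
  have [_ /andP[h4 _]] := arrow_in2 TE.
  by move: h3; rewrite ltNge (le_trans (tie _) h2) //; lra.
have main : [/\ qa = false, reaches_l E q = false, reaches_r E q & reaches_d E q].
  move: n1 n2 n3 n4 a1 b1 a2 b2 D1 tieE (dj true true) (dj true false) (dj false true) (dj false false).
  rewrite /covers /= {dj qT qq PT PE}.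
  move: (reaches_l T q) (reaches_r T q) (reaches_u T q) (reaches_d T q)
        (reaches_l E q) (reaches_r E q) (reaches_u E q) (reaches_d E q); clear.
  by case: qa; do 8!case.
case: main => eqa L2 R2 D2; rewrite eqa in qq.
have [/andP[x1 x2] /andP[y1 y2]] := arrow_in2 TE.
split => //.
- by move: L2; rewrite /reaches_l => /negbT; rewrite -leNgt => h; apply/eqP; rewrite eq_le x1 h.
- by rewrite y2 andbT.
- by apply: covers_quadrant (arrow_in2 TE) _; rewrite /covers R2 D2.
Qed.

Lemma junction_of S1 S2 p qa : arrow S1 S2 p -> quadrant_in V qa false p ->
  ~~ reaches_r S1 p -> ~~ reaches_l S2 p -> reaches_u S1 p -> junction f P V p S1 S2.
Proof.
move=> ar qq; rewrite /reaches_r /reaches_l /reaches_u -!leNgt => h1 h2 h3.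
have [P1 P2] := arrow_valid ar.
have [/andP[x1 x2] /andP[y1 y2]] := arrow_in1 ar.
have [/andP[x1' x2'] /andP[y1' y2']] := arrow_in2 ar.
split => //; try lra.
by exists qa.
Qed.

(** In the degenerate case of [junction_touching] the top square meets [p] at its lower left corner,
    and [E] and [S2] both fill the southeast quadrant there. *)
Lemma junction_top S1 S2 p qa : arrow S1 S2 p -> quadrant_in V qa false p ->
  ~~ reaches_r S1 p -> ~~ reaches_l S2 p -> reaches_u S1 p ->
  [\/ T = S1, T = S2 | E = S2].
Proof.
move=> ar qq h1 h2 h3; have jn := junction_of ar qq h1 h2 h3.
have [P1 P2] := arrow_valid ar; have [PT PE] := arrow_valid TE.
have [l1 ch1] := bottom_chains P1; have [l2 ch2] := bottom_chains P2.
have pT := closure_below_T (boundary_closure (arrow_boundary ar)).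
have [_ [->|->|[qp xT yS]]] := junction_touching pk jn ch1 ch2 PT
  (boundary_closure (arrow_boundary TE)) (arrow_in1 TE) pT; [exact: Or31|exact: Or32|].
have [_ _ _ _ Eq] := end_corner; rewrite qp in Eq.
apply: Or33; apply: (in_quadrant_inj pk PE P2 Eq); apply: covers_quadrant (arrow_in2 ar) _.
have [a2 b2] := reaches_some P2 (arrow_in2 ar).
move: a2 b2 h2; rewrite /covers /=; case: (reaches_l _ _) => //= -> + _ /=.
by rewrite /reaches_u yS ltxx orbF.
Qed.

Lemma side_arrow S1 S2 p : arrow S1 S2 p -> T <> S1 -> T <> S2 -> E <> S1 -> E <> S2 ->
  left_at S1 S2 p \/ up_at S1 S2 p.
Proof.
move=> ar T1 T2 E1 E2; have [|nl] := boolP (left_at S1 S2 p); [by left|right].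
have [qa [qb qq]] := boundary_quadrant (arrow_boundary ar).
have [_ /(_ nl) [[//|[eqb R1 L2 U1]]|[eqa U2 D1 R1 R2]]] := arrow_types ar qq.
  by rewrite eqb in qq; case: (junction_top ar qq R1 L2 U1).
exfalso; rewrite eqa in qq.
have [P1 P2] := arrow_valid ar; have [PT PE] := arrow_valid TE.
have pw : p.1 <= xmin (f wall).
  apply: (closure_sub_closed (@closed_fst_le R _) _ (boundary_closure (arrow_boundary ar))).
  by move=> u /wall_free/ltW.
have nw S : P S -> reaches_r S p -> S <> wall -> p.1 < xmin (f wall).
  by move=> PS; rewrite /reaches_r => h /(wall_right PS); exact: lt_le_trans.
have [/andP[x1 x2] /andP[y1 y2]] := arrow_in1 ar.
have [/andP[x1' x2'] /andP[y1' y2']] := arrow_in2 ar.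
have W1 : S1 <> wall.
  move=> e; have := nw S2 P2 R2; rewrite -e => /(_ (fun e2 => arrow_neq ar (esym e2))).
  by rewrite ltNge x1.
have W2 : S2 <> wall.
  by move=> e; have := nw S1 P1 R1; rewrite -e => /(_ (arrow_neq ar)); rewrite ltNge x1'.
have [l1 ch1] := left_chains P1 W1; have [l2 ch2] := left_chains P2 W2.
have [lE chE] := bottom_chains PE.
have [q2 qq' xE yE _] := end_corner.
have Vq u : V u -> u.2 < q.2 by rewrite q2; exact: below_T.
move: U2 D1 R1 R2; rewrite /reaches_u /reaches_d /reaches_r -!leNgt => U2 D1 R1 R2.
have jn : junction (@swap_rect R \o f) P (swap_set V) (swap p) S2 S1.
  split => //=; [lra|lra|lra|lra|exists qb].
  exact: quadrant_in_swap qq.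
by case: (vertical_junction pk half chE xE yE qq' Vq jn R1 ch1 ch2).
Qed.

Lemma pretop_arrow S p : arrow S T p -> right_at S T p \/ up_at S T p.
Proof.
move=> ar; have pT := touch_T (boundary_closure (arrow_boundary ar)) (arrow_in2 ar).
have [qa [qb qq]] := boundary_quadrant (arrow_boundary ar).
have eqb := quadrant_not_up pT qq; subst qb.
have [n1 n2 n3 n4] := arrow_order ar qq.
have [P1 P2] := arrow_valid ar.
have [a1 b1] := reaches_some P1 (arrow_in1 ar); have [a2 b2] := reaches_some P2 (arrow_in2 ar).
have dj x y := arrow_disjoint x y ar.
have D2 : reaches_d T p = false by rewrite /reaches_d pT ltxx.
move: n1 n2 n3 n4 a1 b1 a2 b2 D2 (dj true true) (dj true false) (dj false true) (dj false false).
rewrite /covers /right_at /up_at /= {dj pT qq P1 P2}.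
move: (reaches_l S p) (reaches_r S p) (reaches_u S p) (reaches_d S p)
      (reaches_l T p) (reaches_r T p) (reaches_u T p) (reaches_d T p).
by case: qa; do 8!case=> //=; auto.
Qed.

Lemma end_arrow : right_at T E q \/ down_at T E q.
Proof.
have [_ qq _ _ _] := end_corner; have [/= h _] := arrow_types TE qq.
by apply/orP.
Qed.

(** Taken in circuit direction, hence left or down; reversal gives (e). An arrow of up type must
    start at the height of the bottom of [T], with [V] below it. There [V] to the southeast would
    not be west of the chain of [E], and to the southwest it would meet [E] unless the type is also
    down. *)
Lemma pen_arrow S p : arrow E S p -> T <> S -> left_at E S p \/ down_at E S p.
Proof.
move=> ar TS; have [|nl] := boolP (left_at E S p); [by left|right].
apply: contrapT => /negP nd.
have [P1 P2] := arrow_valid ar; have [PT PE] := arrow_valid TE.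
have [qa [qb qq]] := boundary_quadrant (arrow_boundary ar).
have [ty /(_ nl) cl] := arrow_types ar qq.
have [up|nup] := boolP (up_at E S p); last first.
  case: cl => [[|[eqb R1 L2 U1]]|[eqa U2 D1 _ _]]; first by rewrite (negbTE nup).
    rewrite eqb in qq; case: (junction_top ar qq R1 L2 U1) => // h.
      exact: (arrow_neq TE).
    exact: (arrow_neq ar).
  by move: nd; rewrite /down_at D1 U2.
have [q2 qq' xE yE _] := end_corner.
have pT := closure_below_T (boundary_closure (arrow_boundary ar)).
have [U1 _] := andP up; move: U1; rewrite /reaches_u -leNgt => U1.
have p2 : p.2 = ymin (f T) by lra.
have eqb := quadrant_not_up p2 qq; subst qb.
have [n1 n2 n3 n4] := arrow_order ar qq.
have [a1 b1] := reaches_some P1 (arrow_in1 ar).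
case: qa qq n1 n2 n3 n4 ty {cl} => qq n1 n2 n3 n4 /= ty.
  have [lE chE] := bottom_chains PE.
  have d0 : 0 < p.2 - ymin (f E) by lra.
  have VW : V `<=` west_of f lE.
    have [s [t [hs ht Vu]]] := quadrant_in_near qq' d0.
    apply: (all_west pk chE _ Vu); first by move=> u /below_T; lra.
    by exists E; [exact: chain_mem chE|split => /=; rewrite /sg; lra].
  have [s [t [hs ht Vu]]] := quadrant_in_near qq d0.
  have /= := west_ofP pk chE Vu (VW _ Vu) (chain_mem chE).
  have [/andP[x1 x2] _] := arrow_in1 ar.
  by rewrite /sg => /(_ (ltac:(lra))); lra.
move: n1 ty nd up a1 b1; rewrite /covers /right_at /down_at /up_at /=.
move: (reaches_l E p) (reaches_r E p) (reaches_u E p) (reaches_d E p)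
      (reaches_l S p) (reaches_r S p) (reaches_u S p) (reaches_d S p); clear.
by do 8!case.
Qed.

End Ends.

End Structure.

(** * The structure theorem *)

Section Faces.
Variable R : realType.
Implicit Types (X : set (pt R)) (g : pt R -> R) (q : pt R).

Lemma ereal_inf_attained X g q : X q -> (forall p, X p -> g q <= g p) ->
  ereal_inf [set (g p)%:E | p in X] = (g q)%:E.
Proof.
move=> Xq h; apply/eqP; rewrite eq_le; apply/andP; split.
  by apply: ereal_inf_lbound; exists q.
by apply: le_ereal_inf_tmp => _ [p Xp <-]; rewrite lee_fin h.
Qed.

Lemma ereal_sup_attained X g q : X q -> (forall p, X p -> g p <= g q) ->
  ereal_sup [set (g p)%:E | p in X] = (g q)%:E.
Proof.
move=> Xq h; apply/eqP; rewrite eq_le; apply/andP; split.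
  by apply: ge_ereal_sup => _ [p Xp <-]; rewrite lee_fin h.
by apply: ereal_sup_ubound; exists q.
Qed.

Variables (W : R) (s : nat -> R) (pos : nat -> pt R) (H : R).
Hypothesis hW : 0 < W.
Let f := thick W s pos H.
Let F := fsq_set W s pos.

Lemma fsq_set_bounds S q : F S q ->
  [/\ xmin (f S) <= q.1, q.1 <= xmax (f S) & ymin (f S) <= q.2].
Proof.
have W0 := hW; case: S => [j|||] /= [h1 h2]; split; lra.
Qed.

Lemma fsq_set_ymax S q : F S q -> q.2 < H -> q.2 <= ymax (f S).
Proof.
by case: S => [j|||] /= [h1 h2] h3; lra.
Qed.

Lemma fsq_set_in_rect S q : F S q -> q.2 < H -> in_rect (f S) q.
Proof.
move=> Fq qH; have [h1 h2 h3] := fsq_set_bounds Fq.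
by split; [rewrite h1 h2|rewrite h3 (fsq_set_ymax Fq qH)].
Qed.

Lemma in_rect_fsq_set S q : strip W q -> in_rect (f S) q -> F S q.
Proof.
by case: S => [j|||] //= [h1 h2] [/= h3 h4]; split => //; lra.
Qed.

Lemma lf_at S q : F S q -> xmin (f S) = q.1 -> lf (F S) = (q.1)%:E.
Proof.
move=> Fq e; apply: (ereal_inf_attained (g := fst)) => // p /fsq_set_bounds[h _ _].
by rewrite -e.
Qed.

Lemma rf_at S q : F S q -> xmax (f S) = q.1 -> rf (F S) = (q.1)%:E.
Proof.
move=> Fq e; apply: (ereal_sup_attained (g := fst)) => // p /fsq_set_bounds[_ h _].
by rewrite -e.
Qed.

Lemma bf_at S q : F S q -> ymin (f S) = q.2 -> bf (F S) = (q.2)%:E.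
Proof.
move=> Fq e; apply: (ereal_inf_attained (g := snd)) => // p /fsq_set_bounds[_ _ h].
by rewrite -e.
Qed.

Lemma tf_at S q : F S q -> q.2 < H -> ymax (f S) = q.2 -> tf (F S) = (q.2)%:E.
Proof.
move=> Fq qH e; apply: (ereal_sup_attained (g := snd)) => // p Fp; rewrite -e.
by case: S Fq e Fp => [j|||] /= Fq e; [case=> _ /andP[]|lra|lra|case=> _ ->].
Qed.

Lemma bf_square j : 0 < s j -> bf (F (FSq j)) = ((pos j).2)%:E.
Proof.
move=> sj; apply: (ereal_inf_attained (q := pos j) (g := snd)).
  by split => /=; lra.
by move=> p [_ /andP[]].
Qed.

Lemma rf_square j : 0 < s j -> rf (F (FSq j)) = ((pos j).1 + s j)%:E.
Proof.
move=> sj; apply: (ereal_sup_attained (q := ((pos j).1 + s j, (pos j).2)) (g := fst)).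
  by split => /=; lra.
by move=> p [/andP[]].
Qed.

Lemma tf_square j : 0 < s j -> tf (F (FSq j)) = ((pos j).2 + s j)%:E.
Proof.
move=> sj; apply: (ereal_sup_attained (q := ((pos j).1, (pos j).2 + s j)) (g := snd)).
  by split => /=; lra.
by move=> p [_ /andP[]].
Qed.

Lemma tf_bottom : tf (F FBottom) = 0%E.
Proof.
apply: (ereal_sup_attained (q := (0, 0)) (g := snd)) => [|p [_ ->]] //=.
by rewrite lexx ltW.
Qed.

Lemma bf_formal S : (if S is FSq _ then False else True) -> bf (F S) = 0%E.
Proof.
have W0 := hW; case: S => // _.
- apply: (ereal_inf_attained (q := (0, 0)) (g := snd)) => [|p []] //=.
- apply: (ereal_inf_attained (q := (W, 0)) (g := snd)) => [|p []] //=.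
- apply: (ereal_inf_attained (q := (0, 0)) (g := snd)) => [|p [_ ->]] //=.
  by rewrite lexx ltW.
Qed.

End Faces.

(** * Index arithmetic on the circuit *)

Section CyclicIndex.

Definition cyc_dist (m x y : nat) : nat := if (x <= y)%N then (y - x)%N else (y + m - x)%N.
Definition cyc_succ (m x : nat) : nat := if x.+1 == m then 0%N else x.+1.

Lemma top_path_index (m st tp a : nat) : (a < m)%N -> (st < m)%N -> (tp < m)%N ->
  st <> tp -> st <> cyc_succ m tp -> (cyc_dist m st a < cyc_dist m st tp - 1)%N ->
  [/\ a <> tp, cyc_succ m a <> tp, a <> cyc_succ m tp & cyc_succ m a <> cyc_succ m tp].
Proof.
rewrite /cyc_dist /cyc_succ => am sm tm.
by case: (a.+1 =P m); case: (tp.+1 =P m); case: (leqP st a); case: (leqP st tp) => *; split; lia.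
Qed.

(** [a] is the source of an arrow in circuit direction; the bottom path runs it backwards, from
    [cyc_succ m a] to [a]. *)
Lemma bottom_path_index (m st tp a : nat) : (a < m)%N -> (st < m)%N -> (tp < m)%N ->
  st <> tp -> st <> cyc_succ m tp ->
  (cyc_dist m (cyc_succ m a) st < cyc_dist m (cyc_succ m tp) st - 1)%N ->
  [/\ a <> tp, cyc_succ m a <> tp, a <> cyc_succ m tp & cyc_succ m a <> cyc_succ m tp].
Proof.
rewrite /cyc_dist /cyc_succ => am sm tm.
by case: (a.+1 =P m); case: (tp.+1 =P m) => ? ? /=; do ?case: ifP => ?; move=> *; split; lia.
Qed.

Lemma top_neq_penultimate (m st tp : nat) : (st < m)%N -> (tp < m)%N ->
  st <> tp -> st <> cyc_succ m tp -> tp <> cyc_succ m (cyc_succ m tp).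
Proof.
rewrite /cyc_succ => sm tm.
by case: (tp.+1 =P m) => ? /=; case: eqP => *; lia.
Qed.

Variable C : seq fsq.

Lemma fwdE i j : (0 < size C)%N -> fwd C i j =
  cyc_dist (size C) (i %% size C) (j %% size C).
Proof.
move=> m0; rewrite /fwd /cyc_dist.
have hi := ltn_pmod i m0; have hj := ltn_pmod j m0.
case: leqP => h; last by rewrite modn_small //; lia.
rewrite (_ : (_ + _ - _)%N = (j %% size C - i %% size C + size C)%N); last by lia.
by rewrite modnDr modn_small //; lia.
Qed.

Lemma succ_modE i : (0 < size C)%N ->
  (i.+1 %% size C)%N = cyc_succ (size C) (i %% size C).
Proof.
rewrite /cyc_succ => m0; have hi := ltn_pmod i m0.
rewrite -addn1 -modnDml addn1; case: eqP => [->|h]; first by rewrite modnn.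
by rewrite modn_small //; lia.
Qed.

Lemma cnth_inj i j : uniq C -> (0 < size C)%N -> cnth C i = cnth C j ->
  (i %% size C = j %% size C)%N.
Proof.
by move=> uC m0 /eqP; rewrite nth_uniq ?ltn_pmod// => /eqP.
Qed.

End CyclicIndex.

Theorem theorem7 (R : realType) (W : R) (n : nat) (s : nat -> R)
  (pos : nat -> (R * R)%type)
  (hW : 0 < W) (hs : forall j, (j < n)%N -> 0 < s j <= W)
  (hBL : bottom_left W n s pos)
  (k : nat) (hk : (k < n)%N) (U : set (R * R)%type)
  (hU : pieces W s pos k U)
  (C : seq fsq) (hC : clockwise_circuit W s pos k U C)
  (st tp : nat) (hst : is_start W s pos C st) (htp : is_top W s pos C tp) :
  let m := size C in
  let F i := fsq_set W s pos (cnth C i) in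
  let en := tp.+1 in
  let pretop := (tp + m - 1)%N in
  let pen := en.+1 in
  [/\ (* (a) top path, arrows between start and pre-top *)
      (forall i, (fwd C st i < fwd C st tp - 1)%N ->
         left_type (F i) (F i.+1) \/ up_type (F i) (F i.+1)),
      (* (b) pre-top -> top *)
      right_type (F pretop) (F tp) \/ up_type (F pretop) (F tp),
      (* (c) top -> end *)
      right_type (F tp) (F en) \/ down_type (F tp) (F en),
      (* (d) bottom path (runs against C), arrows between start and penultimate *)
      (forall i, (fwd C i st < fwd C en st - 1)%N ->
         right_type (F i) (F (i + m - 1)%N) \/ down_type (F i) (F (i + m - 1)%N)) &
      (* (e) penultimate -> end *)
      right_type (F pen) (F en) \/ up_type (F pen) (F en)].
Proof.
move=> /=.
have Uloc := piece_local hU.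
have [[x [sx nx] eU] [M bM]] := hU.
have UO : U `<=` strip W `\` (Defs.cover W s pos k `|` csq s pos k).
  by rewrite eU; exact: connected_component_sub.
have Ux : U x by rewrite eU; apply: connected_component_refl.
have Uconn : connected U by rewrite eU; exact: component_connected.
have Ustrip : U `<=` strip W by move=> p /UO[].
have Usq j p : (j <= k)%N -> U p -> ~ csq s pos j p.
  move=> jk Up cj; case: (UO p Up) => _; apply.
  move: jk; rewrite leq_eqVlt => /predU1P[<-|jk]; first by right.
  by left; apply: (@csq_cover R W s pos k j jk).
(* The margin 1 puts the closure of the piece strictly below [H], so the artificial upper ends of
   the walls are never met. *)
pose H := M + 1.
have M0 : 0 <= M by have [h _] := bM x Ux; exact: le_trans h.
have H0 : 0 < H by rewrite /H; lra.
pose V := U `&` open_strip W.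
have oV : open V := open_part_open Uloc.
have cVU : closure V = closure U := open_part_closure hW Ustrip Uloc.
have iUV : interior U = V := open_part_interior Ustrip Uloc.
have cV : connected V := open_part_connected hW Ustrip Uconn Uloc.
have V0 : V !=set0.
  have [q Vq _] := open_part_near hW Ustrip Uloc (subset_closure Ux) (@ltr01 R).
  by exists q.
have closU p : closure U p -> strip W p /\ p.2 < H.
  move=> cp; split.
    split; last first.
      by apply: (closure_sub_closed (@closed_snd_ge R 0) _ cp) => u /Ustrip[].
    apply/andP; split.
      by apply: (closure_sub_closed (@closed_fst_ge R 0) _ cp) => u /Ustrip[/andP[]].
    by apply: (closure_sub_closed (@closed_fst_le R W) _ cp) => u /Ustrip[/andP[]].
  apply: (@le_lt_trans _ _ M); last by rewrite /H; lra.
  apply: (closure_sub_closed (@closed_snd_le R M) _ cp) => u /bM[_].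
  by rewrite ler_norml => /andP[].
pose f := thick W s pos H.
have pk : packing f (fsq_valid k) V.
  split.
  - exact: (@thick_nondeg R W n s pos hW hs k H hk H0).
  - exact: (@thick_disj R W n s pos hW hs hBL k H hk).
  - exact: cV.
  - move=> S p vS [Up [p1 p2]] [/= hx hy]; case: S vS hx hy => [j|||] /= vS hx hy; [|clear - hx hy p1 p2; lra..].
    by case: (Usq j p vS Up); split.
  - by move=> p [_ [/andP[]]].
have [uC memC [gamma [gcont [gper ginj] gim gright [b [bmono bclose barc]]]]] := hC.
have m0 : (0 < size C)%N by case: htp => h _; exact: leq_ltn_trans h.
have gtime q : boundary U q <-> exists t, gamma t = q.
  split; first by move=> /gim[t [_ <-]]; exists t.
  move=> [t <-]; apply/gim; have [t' ht' <-] := gamma_time gper 0 t.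
  by exists t'; split => //; lra.
have ct : circuit f (fsq_valid k) U V (boundary U) gamma C FBottom b.
  split => //.
  - by rewrite /boundary iUV -cVU => p; split=> [[]|].
  - by move=> S /memC[].
  - move=> S q vS Uq; have [q1 q2] := Ustrip q Uq.
    case: S vS => [j|||] /= vS hx hy; [|clear - hx hy q1 q2; lra..].
    by case: (Usq j q vS Uq); clear - hx hy; split; lra.
  - move=> i im t ht; apply: fsq_set_in_rect => //; first exact: barc.
    by have [cg _] : boundary U (gamma t) by [apply/gtime; exists t]; case: (closU _ cg).
have VM u : V u -> u.2 < H by move=> [Uu _]; case: (closU u (subset_closure Uu)).
have half := @thick_half R W n s pos hBL k H hk.
have bch := @bottom_chain R W n s pos hs hBL k H hk.
have lch := @left_chain R W n s pos hs hBL k H hk.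
have wr S : fsq_valid k S -> S <> FRight -> xmax (f S) <= xmin (f FRight).
  case: S => [j|||] //= vS _; last by exact: ltW.
  by have [] := square_in_strip hBL hk vS.
have wf u : V u -> u.1 < xmin (f FRight) by move=> [_ [/andP[]]].
have nthC j : (j < size C)%N -> cnth C j = nth FBottom C j by move=> jm; rewrite /cnth modn_small.
have memn i : cnth C i \in C by apply: mem_nth; rewrite ltn_mod.
have [tpm top] := htp; have [stm start] := hst.
have idx A : A \in C -> exists2 j, (j < size C)%N & A = cnth C j.
  by move=> AC; exists (index A C); rewrite ?nthC ?nth_index // index_mem.
have sq0 j : fsq_valid k (FSq j) -> 0 < s j.
  by move=> jk; have [] := andP (hs j (leq_ltn_trans jk hk)).
have [u0 Vu0] := V0; have u00 : 0 < u0.2 by case: (packing_pos pk Vu0).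
pose T := cnth C tp; pose E := cnth C tp.+1.
(* Above each point of [V] some square of [C] has its bottom, and that of the top square is at least
   as high. Formal squares have bottom 0, so the top square is a genuine one. *)
have bfT : exists2 t, T = FSq t & forall u, V u -> u.2 < (pos t).2.
  have bfA u : V u -> (u.2%:E < bf (fsq_set W s pos T))%E.
    move=> Vu; have [A AC [_ Au]] := square_above ct oV VM Vu.
    have [j jm eA] := idx A AC; have [/= le _] := top j jm; apply: lt_le_trans le.
    rewrite -eA; have u2 : 0 < u.2 by case: (packing_pos pk Vu).
    have [vA _] := (memC A).1 AC.
    case: A Au vA {eA AC} => [a|||] /= Au vA; [|exfalso; clear - Au u2; lra..].
    by rewrite (bf_square W pos (sq0 a vA)) lte_fin.
  have [vT _] := (memC T).1 (memn tp).
  case: T bfA vT => [t|||] bfA vT.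
  - by exists t => // u /bfA; rewrite (bf_square W pos (sq0 t vT)) lte_fin.
  - by have := bfA u0 Vu0; rewrite (bf_formal s pos hW) // lte_fin; lra.
  - by have := bfA u0 Vu0; rewrite (bf_formal s pos hW) // lte_fin; lra.
  - by have := bfA u0 Vu0; rewrite (bf_formal s pos hW) // lte_fin; lra.
have [t eT Vt] := bfT.
have below u : V u -> u.2 < ymin (f T) by rewrite eT; exact: Vt.
have tie : ymin (f E) = ymin (f T) -> xmax (f E) <= xmax (f T).
  have [j jm eE] := idx E (memn tp.+1); have [_] := top j jm.
  rewrite -/T -eE eT; have [vE _] := (memC E).1 (memn tp.+1); have [vT _] := (memC T).1 (memn tp).
  have t0 : 0 < (pos t).2 by apply: lt_trans u00 (Vt u0 Vu0).
  case: E vE {eE} => [e|||] /= vE; [|clear - t0; lra..].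
  rewrite eT in vT; rewrite !(bf_square W pos) ?(rf_square W pos) ?sq0 // => h e'.
  by move: h; rewrite lee_fin e'; apply.
have TC i : exists2 p, closure U p & fsq_set W s pos (cnth C i) p.
  by have [_ [p [cp Fp]]] := (memC _).1 (memn i); exists p.
have st_low : (tf (fsq_set W s pos (cnth C st)) < (u0.2)%:E)%E.
  have [A AC [Ax Au]] := square_below ct oV VM Vu0.
  have [j jm eA] := idx A AC; have [/= le _] := start j jm; apply: le_lt_trans le _.
  have [_ [/andP[u1 u1'] _]] := Vu0.
  rewrite -eA; have [vA _] := (memC A).1 AC.
  case: A Ax Au vA {eA AC} => [a|||] /= Ax Au vA; [|exfalso; clear - Ax u1; lra|exfalso; clear - Ax u1'; lra|].
    by rewrite tf_square ?sq0 // lte_fin.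
  by rewrite tf_bottom // lte_fin.
(* The start square ends below [u0], whereas the top and end squares contain points above [u0]; so
   it is neither of them. *)
have st_neq i p : fsq_set W s pos (cnth C i) p -> u0.2 < p.2 -> st <> (i %% size C)%N.
  move=> Fp up e; move: st_low; rewrite e /cnth modn_mod ltNge => /negP; apply.
  apply: (@le_trans _ _ (p.2)%:E); first by rewrite lee_fin ltW.
  by apply: ereal_sup_ubound; exists p.
have sttp : st <> tp.
  have [p cp Fp] := TC tp; rewrite -(modn_small tpm); apply: (st_neq _ p Fp).
  have [_ _ h] := fsq_set_bounds H hW Fp.
  exact: lt_le_trans (below u0 Vu0) h.
have m1 : (1 < size C)%N by clear - stm tpm sttp; lia.
have arr i : exists p, arrow f V (boundary U) C (cnth C i) (cnth C i.+1) p.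
  exists (gamma (b (i %% size C).+1)).
  have e : ((i %% size C).+1 %% size C = i.+1 %% size C)%N by rewrite -addn1 modnDml addn1.
  by have := circuit_arrow ct oV V0 VM m1 (ltn_pmod i m0); rewrite e.
have on S1 S2 p : arrow f V (boundary U) C S1 S2 p ->
    [/\ fsq_set W s pos S1 p, fsq_set W s pos S2 p & p.2 < H].
  move=> ar; have [cp _] := arrow_boundary ar; have [sp pH] := closU p cp.
  by split=> //; apply: in_rect_fsq_set => //; [exact: (arrow_in1 ar)|exact: (arrow_in2 ar)].
have leftP S1 S2 p : arrow f V (boundary U) C S1 S2 p -> left_at f S1 S2 p ->
    left_type (fsq_set W s pos S1) (fsq_set W s pos S2).
  move=> ar /andP[]; rewrite /reaches_l /reaches_r -!leNgt => h1 h2.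
  have [F1 F2 pH] := on _ _ _ ar.
  have [/andP[x1 _] _] := arrow_in1 ar; have [/andP[_ x2] _] := arrow_in2 ar.
  rewrite /left_type (lf_at (H := H) hW F1) 1?(rf_at (H := H) hW F2) //;
    by apply/eqP; rewrite eq_le ?x1 ?x2 ?h1 ?h2.
have rightP S1 S2 p : arrow f V (boundary U) C S1 S2 p -> right_at f S1 S2 p ->
    right_type (fsq_set W s pos S1) (fsq_set W s pos S2).
  move=> ar /andP[]; rewrite /reaches_l /reaches_r -!leNgt => h1 h2.
  have [F1 F2 pH] := on _ _ _ ar.
  have [/andP[_ x1] _] := arrow_in1 ar; have [/andP[x2 _] _] := arrow_in2 ar.
  rewrite /right_type (rf_at (H := H) hW F1) 1?(lf_at (H := H) hW F2) //;
    by apply/eqP; rewrite eq_le ?x1 ?x2 ?h1 ?h2.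
have upP S1 S2 p : arrow f V (boundary U) C S1 S2 p -> up_at f S1 S2 p ->
    up_type (fsq_set W s pos S1) (fsq_set W s pos S2).
  move=> ar /andP[]; rewrite /reaches_u /reaches_d -!leNgt => h1 h2.
  have [F1 F2 pH] := on _ _ _ ar.
  have [_ /andP[_ y1]] := arrow_in1 ar; have [_ /andP[y2 _]] := arrow_in2 ar.
  rewrite /up_type (tf_at (H := H) F1) 1?(bf_at (H := H) hW F2) //;
    by apply/eqP; rewrite eq_le ?y1 ?y2 ?h1 ?h2.
have downP S1 S2 p : arrow f V (boundary U) C S1 S2 p -> down_at f S1 S2 p ->
    down_type (fsq_set W s pos S1) (fsq_set W s pos S2).
  move=> ar /andP[]; rewrite /reaches_u /reaches_d -!leNgt => h1 h2.
  have [F1 F2 pH] := on _ _ _ ar.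
  have [_ /andP[y1 _]] := arrow_in1 ar; have [_ /andP[_ y2]] := arrow_in2 ar.
  rewrite /down_type (bf_at (H := H) hW F1) 1?(tf_at (H := H) F2) //;
    by apply/eqP; rewrite eq_le ?y1 ?y2 ?h1 ?h2.
have [q TE] := arr tp.
have [q2 _ _ _ _] := end_corner ct oV TE below tie.
have sten : st <> (tp.+1 %% size C)%N.
  have [_ Fq _] := on _ _ _ TE; apply: (st_neq tp.+1 q Fq).
  by rewrite q2; exact: below.
rewrite succ_modE // (modn_small tpm) in sten.
have neq i j : (i %% size C <> j %% size C)%N -> cnth C i <> cnth C j.
  by move=> ij /(cnth_inj uC m0).
have side i : (i %% size C <> tp)%N -> (i.+1 %% size C <> tp)%N ->
    (i %% size C <> tp.+1 %% size C)%N -> (i.+1 %% size C <> tp.+1 %% size C)%N ->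
    exists2 p, arrow f V (boundary U) C (cnth C i) (cnth C i.+1) p &
      left_at f (cnth C i) (cnth C i.+1) p \/ up_at f (cnth C i) (cnth C i.+1) p.
  move=> h1 h2 h3 h4; have [p ar] := arr i; exists p => //.
  apply: (side_arrow ct oV half bch lch wr wf TE below tie ar); apply: neq; rewrite ?(modn_small tpm);
    by move/esym.
have predK i : cnth C (i + size C - 1).+1 = cnth C i.
  by rewrite /cnth -addn1 subnK ?modnDr //; rewrite addn_gt0 m0 orbT.
split.
- move=> i; rewrite !fwdE // (modn_small tpm) (modn_small stm) => hi.
  have [h1 h2 h3 h4] := top_path_index (ltn_pmod i m0) stm tpm sttp sten hi.
  have [||||p ar] := side i; rewrite ?succ_modE ?(modn_small tpm) //.
  by case=> [/(leftP _ _ _ ar)|/(upP _ _ _ ar)]; [left|right].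
- have [p] := arr (tp + size C - 1)%N; rewrite predK => ar.
  by case: (pretop_arrow ct oV below ar) => [/(rightP _ _ _ ar)|/(upP _ _ _ ar)]; [left|right].
- by case: (end_arrow ct oV TE below tie) => [/(rightP _ _ _ TE)|/(downP _ _ _ TE)]; [left|right].
(* [j] is the predecessor of [i]; adding the size first avoids truncation at 0. The circuit arrow
   from [j] to [i] is reversed by [esym]. *)
- move=> i; pose j := (i + size C - 1)%N.
  have ji : (i %% size C)%N = cyc_succ (size C) (j %% size C).
    by rewrite -succ_modE // /j -addn1 subnK ?modnDr // addn_gt0 m0 orbT.
  rewrite !fwdE // (modn_small stm) ji succ_modE // (modn_small tpm) => hi.
  have [h1 h2 h3 h4] := bottom_path_index (ltn_pmod j m0) stm tpm sttp sten hi.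
  have [||||p ar] := side j; rewrite ?succ_modE ?(modn_small tpm) //.
  have eji : cnth C j.+1 = cnth C i := predK i.
  rewrite eji in ar *.
  by case=> [/(leftP _ _ _ ar)/esym|/(upP _ _ _ ar)/esym]; [left|right].
- have [p ar] := arr tp.+1.
  have Tp : T <> cnth C tp.+2.
    apply: neq; rewrite !succ_modE // (modn_small tpm).
    exact: (top_neq_penultimate stm tpm sttp sten).
  by case: (pen_arrow ct oV bch TE below tie ar Tp) => [/(leftP _ _ _ ar)/esym|/(downP _ _ _ ar)/esym];
    [left|right].
Qed.
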